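(* Consider the unified distributed SGD iteration described in the context and suppose Assumptions (A) (regularity of the gradient), (C) (step size and communication interval), (D) (stability) and (E) (contraction of the communication matrix) given there hold. Let $\Theta_n=[(\theta_n^1)^T,\dots,(\theta_n^N)^T]^T\in\mathbb R^{Nd}$, $\mathcal J_\bot=(I_N-J)\otimes I_d$, and define $\phi_n=\gamma_{n+1}^{-1}\mathcal J_\bot\Theta_n$ in case (C-i) and $\phi_n=\eta_{n+1}^{-1}\mathcal J_\bot\Theta_n$ in case (C-ii). Then for any compact set $\Omega\subset\mathbb R^{Nd}$, $$\sup_n\ \mathbb E\Big[\|\phi_n\|^2\,\mathbb 1_{\bigcap_{j\le n-1}\{\Theta_j\in\Omega\}}\Big]<\infty .$$
   Context: Setting. $N\ge1$ agents, $[N]=\{1,\dots,N\}$. Agent $i$ has a finite data set $\mathcal X_i$ and a function $F_i:\mathbb R^d\times\mathcal X_i\to\mathbb R$, differentiable in its first argument $\theta$; $\nabla F_i(\theta,X)$ is the gradient in $\theta$. Agent $i$ samples data along a Markovian trajectory $\{X_n^i\}_{n\ge0}$ in $\mathcal X_i$ with stationary distribution $\pi_i$ such that $f_i(\theta)=\mathbb E_{X\sim\pi_i}[F_i(\theta,X)]$. The objective is $f=\frac1N\sum_{i=1}^N f_i$, and $\mathcal L$ denotes the set of local minima of $f$. Iteration (unified distributed SGD). From initial points $\theta_0^i\in\mathbb R^d$, for $n\ge0$, $$\theta_{n+1}^i=\sum_{j=1}^N w_n(i,j)\big(\theta_n^j-\gamma_{n+1}\nabla F_j(\theta_n^j,X_n^j)\big),\qquad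 i\in[N],$$ with step sizes $\gamma_n>0$ and (possibly random) communication matrices $W_n=[w_n(i,j)]_{i,j\in[N]}$. Given positive integers $K_1,K_2,\dots$ (communication intervals), $n_l=\sum_{m=1}^l K_m$ is the time of the $l$-th aggregation, $W_n=I_N$ if $n\notin\{n_l:l\ge1\}$, and $\tau_n=\min\{l:n_l\ge n\}$. $\|\cdot\|$ is the Euclidean norm for vectors and the spectral norm for matrices; $\mathbf 1$ is the all-ones vector; $J=\mathbf 1\mathbf 1^T/N$; $\otimes$ is the Kronecker product; $\mathbb 1_E$ is the indicator of an event $E$; $A\succeq B$ means $x^T(A-B)x\ge0$ for all $x$. Assumption (A). There is $L>0$ such that for all $i\in[N]$, $X\in\mathcal X_i$, $\theta_1,\theta_2\in\mathbb R^d$: $\|\nabla F_i(\theta_1,X)-\nabla F_i(\theta_2,X)\|\le L\|\theta_1-\theta_2\|$. In addition, $f$ is twice continuously differentiable and strongly convex (only) around the local minima: there is $\mu>0$ with $\nabla^2 f(\theta^* )\succeq\mu I_d$ for $\theta^*\in\mathcal L$. Assumption (C). Either (C-i): the communication intervals are bounded, $K_{\tau_n}\le K$ for all $n$, and $\gamma_n=1/n^a$ with $a\in(0.5,1]$; or (C-ii): $K_{\tau_n}\to\infty$ as $n\to\infty$, $\gamma_n=1/n$, and with $\eta_n=\gamma_nK_{\tau_n}^{L+1}$ ($L$ the Lipschitz constant of (A)) one has $\sum_n\eta_n^2<\infty$, $K_{\tau_n}=o(\gamma_n^{-1/(2(L+1))})$ and $\lim_{l\to\infty}\eta_{n_l+1}/\eta_{n_{l+1}+1}=1$.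 Assumption (D). $\sup_n\|\theta_n^i\|<\infty$ almost surely for every $i\in[N]$. Assumption (E). (i) $\{W_n\}_{n\ge0}$ is independent of $\{X_n^i\}_{n\ge0}$ for all $i\in[N]$, and every $W_n$ is doubly stochastic (nonnegative entries, $W_n\mathbf 1=\mathbf 1$, $\mathbf 1^TW_n=\mathbf 1^T$). (ii) At each aggregation time $n_l$, $W_{n_l}$ is independently generated from some distribution $\mathcal P_{n_l}$ such that $\|\mathbb E_{W\sim\mathcal P_{n_l}}[W^TW]-J\|\le C_1<1$ for some constant $C_1$ (not depending on $l$). *)

(* Defs.v *)
From HB Require Import structures.
From mathcomp Require Import all_boot all_order all_algebra.
From mathcomp Require Import mxtens.
From mathcomp Require Import all_classical all_reals all_analysis.
Import Order.TTheory GRing.Theory Num.Theory.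
Import numFieldNormedType.Exports.

Set Implicit Arguments.
Unset Strict Implicit.
Unset Printing Implicit Defensive.

Local Open Scope classical_set_scope.
Local Open Scope ring_scope.

(* The library norm `|_| on matrices is the entrywise maximum, hence the
   explicit Euclidean and spectral norms. *)
Definition norm2 (R : realType) (n : nat) (v : 'cV[R]_n) : R :=
  Num.sqrt (\sum_(i < n) v i ord0 ^+ 2).

Definition spectral_norm (R : realType) (m n : nat) (A : 'M[R]_(m, n)) : R :=
  sup [set norm2 (A *m x) | x in [set x : 'cV[R]_n | norm2 x <= 1]].

Definition loewner_ge (R : realType) (n : nat) (A B : 'M[R]_n) : Prop :=
  forall x : 'cV[R]_n, 0 <= (x^T *m (A - B) *m x) ord0 ord0.

Definition grad (R : realType) (d : nat) (f : 'cV[R]_d -> R) (t : 'cV[R]_d) :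
    'cV[R]_d :=
  \col_(k < d) 'D_(delta_mx k ord0) f t.

Definition hessian (R : realType) (d : nat) (f : 'cV[R]_d -> R)
    (t : 'cV[R]_d) : 'M[R]_d :=
  \matrix_(k < d, l < d) 'D_(delta_mx l ord0) (fun u => grad f u k ord0) t.

Definition twice_cont_diff (R : realType) (d : nat) (f : 'cV[R]_d -> R) : Prop :=
  [/\ forall t, differentiable f t,
      forall t, differentiable (grad f) t
    & continuous (hessian f)].

Definition local_min (R : realType) (d : nat) (f : 'cV[R]_d -> R)
    (t : 'cV[R]_d) : Prop :=
  \forall u \near t, f t <= f u.

Definition avg_mx (R : realType) (N : nat) : 'M[R]_N := const_mx (N%:R^-1).

Definition doubly_stochastic (R : realType) (N : nat) (W : 'M[R]_N) : Prop :=
  [/\ forall i j, 0 <= W i j,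
      W *m const_mx 1 = const_mx 1 :> 'cV[R]_N
    & const_mx 1 *m W = const_mx 1 :> 'rV[R]_N].

Definition stationary_dist (R : realType) (S : finType) (Q : S -> S -> R)
    (p : S -> R) : Prop :=
  [/\ forall x, 0 <= p x, \sum_x p x = 1
    & forall y, \sum_x p x * Q x y = p y].

Definition transition_matrix (R : realType) (S : finType) (Q : S -> S -> R) :
    Prop :=
  forall x, (forall y, 0 <= Q x y) /\ \sum_y Q x y = 1.

Definition path_event (T : Type) (S : finType) (X : nat -> T -> S)
    (x : nat -> S) (n : nat) : set T :=
  \bigcap_(k in [set k | (k <= n)%N]) (X k @^-1` [set x k]).

(* Time-homogeneous chain with arbitrary initial law; stated multiplicatively,
   so that no conditioning on null paths is needed. *)
Definition markov_chain (dT : measure_display) (T : measurableType dT)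
    (R : realType) (P : probability T R) (S : finType) (Q : S -> S -> R)
    (X : nat -> T -> S) : Prop :=
  [/\ transition_matrix Q,
      forall n x, measurable (X n @^-1` [set x])
    & forall n x, P (path_event X x n.+1) =
        (P (path_event X x n) * (Q (x n) (x n.+1))%:E)%E].

Definition independent_sigma (dT : measure_display) (T : measurableType dT)
    (R : realType) (P : probability T R) (G H : set (set T)) : Prop :=
  forall A B, G A -> H B -> P (A `&` B) = (P A * P B)%E.

Definition mutually_independent_sigma (dT : measure_display)
    (T : measurableType dT) (R : realType) (P : probability T R)
    (G : nat -> set (set T)) : Prop :=
  forall (s : seq nat) (A : nat -> set T), uniq s ->
    (forall l, l \in s -> G l (A l)) ->
    P (\bigcap_(l in [set l | l \in s]) A l) = (\prod_(l <- s) P (A l))%E.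

(* The sigma-algebra generated by the matrices W_n, n in D. *)
Definition sigma_comm (T : Type) (R : realType) (N : nat)
    (W : nat -> T -> 'M[R]_N) (D : set nat) : set (set T) :=
  <<s [set E | exists n i j (B : set R), [/\ D n, measurable B
             & E = (fun w => W n w i j) @^-1` B]] >>.

(* The sigma-algebra generated by all the trajectories of all the agents. *)
Definition sigma_data (T : Type) (N : nat) (S : 'I_N -> finType)
    (X : forall i : 'I_N, nat -> T -> S i) : set (set T) :=
  <<s [set E | exists i n (x : S i), E = X i n @^-1` [set x]] >>.

Definition local_objective (R : realType) (d : nat) (S : finType)
    (p : S -> R) (F : 'cV[R]_d -> S -> R) (t : 'cV[R]_d) : R :=
  \sum_x p x * F t x.

Definition objective (R : realType) (d N : nat) (S : 'I_N -> finType)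
    (p : forall i : 'I_N, S i -> R)
    (F : forall i : 'I_N, 'cV[R]_d -> S i -> R) (t : 'cV[R]_d) : R :=
  N%:R^-1 * \sum_(i < N) local_objective (p i) (F i) t.

Fixpoint dsgd (T : Type) (R : realType) (d N : nat) (S : 'I_N -> finType)
    (F : forall i : 'I_N, 'cV[R]_d -> S i -> R)
    (X : forall i : 'I_N, nat -> T -> S i)
    (W : nat -> T -> 'M[R]_N) (gamma : nat -> R)
    (theta0 : 'I_N -> 'cV[R]_d) (n : nat) (w : T) : 'I_N -> 'cV[R]_d :=
  match n with
  | 0 => theta0
  | m.+1 => fun i =>
      let th := dsgd F X W gamma theta0 m w in
      \sum_(j < N) W m w i j *:
        (th j - gamma m.+1 *: grad (fun t => F j t (X j m w)) (th j))
  end.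

Definition stack (R : realType) (N d : nat) (th : 'I_N -> 'cV[R]_d) :
    'cV[R]_(N * d) :=
  \col_k th (mxtens_unindex k).1 (mxtens_unindex k).2 ord0.

Definition disagreement_mx (R : realType) (N d : nat) : 'M[R]_(N * d) :=
  (1%:M - avg_mx R N) *t (1%:M : 'M[R]_d).

(* The communication intervals are K 1, K 2, ...; the value K 0 is unused. *)
Definition agg_time (K : nat -> nat) (l : nat) : nat :=
  \sum_(1 <= m < l.+1) K m.

Lemma agg_time_unbounded (K : nat -> nat)
    (Kpos : forall m, (0 < m)%N -> (0 < K m)%N) (n : nat) :
  exists l, (0 < l)%N && (n <= agg_time K l)%N.
Proof.
exists n.+1; apply: leq_trans (leqnSn n) _.
elim: (n.+1) => [//|k IH]; rewrite /agg_time big_nat_recr //=.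
by rewrite -[leqLHS]addn1; apply: leq_add; [exact: IH|exact: Kpos].
Qed.

(* The minimum is over l >= 1, where K is meaningful; this only matters for
   n = 0, where it gives 1. *)
Definition tau (K : nat -> nat) (Kpos : forall m, (0 < m)%N -> (0 < K m)%N)
    (n : nat) : nat :=
  ex_minn (agg_time_unbounded Kpos n).

Definition eff_step (R : realType) (K : nat -> nat)
    (Kpos : forall m, (0 < m)%N -> (0 < K m)%N) (gamma : nat -> R) (L : R)
    (n : nat) : R :=
  gamma n * (K (tau Kpos n))%:R `^ (L + 1).

Definition regular_gradients (R : realType) (d N : nat) (S : 'I_N -> finType)
    (p : forall i : 'I_N, S i -> R)
    (F : forall i : 'I_N, 'cV[R]_d -> S i -> R) (L : R) : Prop :=
  let f := objective p F in
  [/\ 0 < L,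
      forall i x t u,
        norm2 (grad (F i ^~ x) t - grad (F i ^~ x) u) <= L * norm2 (t - u),
      twice_cont_diff f
    & exists2 mu : R, 0 < mu &
        forall t, local_min f t -> loewner_ge (hessian f t) mu%:M].

Definition bounded_intervals (R : realType) (K : nat -> nat)
    (Kpos : forall m, (0 < m)%N -> (0 < K m)%N) (gamma : nat -> R) : Prop :=
  (exists K0 : nat, forall n, (K (tau Kpos n) <= K0)%N) /\
  (exists a : R, [/\ 1 / 2 < a, a <= 1 &
     forall n, (0 < n)%N -> gamma n = 1 / n%:R `^ a]).

Definition increasing_intervals (R : realType) (K : nat -> nat)
    (Kpos : forall m, (0 < m)%N -> (0 < K m)%N) (gamma : nat -> R) (L : R) :
    Prop :=
  [/\ (fun n => K (tau Kpos n)) @ \oo --> \oo,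
      forall n, (0 < n)%N -> gamma n = 1 / n%:R,
      (\sum_(1 <= n <oo) ((eff_step Kpos gamma L n) ^+ 2)%:E < +oo)%E,
      (fun n => (K (tau Kpos n))%:R : R) =o_\oo
        (fun n => gamma n `^ (- (1 / (2 * (L + 1)))))
    & (fun l => eff_step Kpos gamma L (agg_time K l).+1 /
                eff_step Kpos gamma L (agg_time K l.+1).+1) @ \oo --> (1 : R)].

Definition expected_gram (dT : measure_display) (T : measurableType dT)
    (R : realType) (P : probability T R) (N : nat) (W : T -> 'M[R]_N) :
    'M[R]_N :=
  \matrix_(i < N, j < N) fine 'E_P[fun w => ((W w)^T *m W w) i j]%E.

Definition contractive_communication (dT : measure_display)
    (T : measurableType dT) (R : realType) (P : probability T R) (N : nat)
    (S : 'I_N -> finType) (X : forall i : 'I_N, nat -> T -> S i)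
    (W : nat -> T -> 'M[R]_N) (K : nat -> nat) : Prop :=
  [/\ independent_sigma P (sigma_comm W setT) (sigma_data X),
      forall n w, doubly_stochastic (W n w),
      mutually_independent_sigma P
        (fun l => sigma_comm W [set agg_time K l.+1])
    & exists2 C1 : R, C1 < 1 & forall l, (0 < l)%N ->
        spectral_norm (expected_gram P (W (agg_time K l)) - avg_mx R N) <= C1].

Definition bounded_second_moment_on (dT : measure_display)
    (T : measurableType dT) (R : realType) (P : probability T R) (m : nat)
    (Theta phi : nat -> T -> 'cV[R]_m) (Omega : set 'cV[R]_m) : Prop :=
  (ereal_sup (range (fun n =>
     'E_P[fun w => (norm2 (phi n w) ^+ 2 *
       \1_(\bigcap_(j in [set j | (j < n)%N]) (Theta j @^-1` Omega)) w)%R]))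
   < +oo)%E.

(* Main.v *)
(* Let D_n be the matrix of deviations from the average and 1_n the indicator of
   the event that Theta_j lies in Omega for all j < n. On this event the
   gradients are bounded by a constant g, so away from the aggregation times
   the L^2 norm of D_n 1_n grows by at most g gamma_{n+1} per step. At an
   aggregation time, W_n is independent of the past and annihilates the average,
   so the squared L^2 norm is moreover contracted by a factor c^2 < 1. Hence this
   L^2 norm is at most x_n, where x_{n+1} = c_n (x_n + g gamma_{n+1}) with
   c_n = c or 1. Over a whole block, x is multiplied by c up to an additive term
   of the order of the normalising sequence s; since s varies slowly from one
   aggregation time to the next, x_n = O(s_{n+1}). *)
Require Import Defs.
From HB Require Import structures.
From mathcomp Require Import all_boot all_order all_algebra.
From mathcomp Require Import mxtens.
From mathcomp Require Import all_classical all_reals all_analysis.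
From mathcomp Require Import measurable_realfun.
From mathcomp Require Import ring lra zify.
Import Order.TTheory GRing.Theory Num.Theory.
Import numFieldNormedType.Exports.
Set Implicit Arguments.
Unset Strict Implicit.
Unset Printing Implicit Defensive.
Local Open Scope classical_set_scope.
Local Open Scope ring_scope.

(** * Frobenius norm and centering *)

Section LinearAlgebra.
Context {R : realType}.

(** Assumption (E) contracts only in expectation, so an aggregation helps only if W_n is independent
    of everything the deviations and the indicator have used so far. (E) gives this in two pieces,
    independence of all the matrices from the data and mutual independence of the matrices at
    aggregation times, and a pi-system argument joins them. The index of the indicator is chosen
    accordingly: 1_{n+1} involves Theta_j for j <= n, hence only matrices before W_n, and yet it
    controls the gradients taken at Theta_n. The same indicator thus serves the gradient bound and
    the mixing step. Dividing by s costs a factor r per block, which is harmless as long as c r < 1;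
    so it is enough that the ratio of s over a block is eventually below 1 + e for a small e. In
    case (C-i) this holds because a block of bounded length is short compared with its starting
    time. In case (C-ii) it is the assumed limit for eta, and K^(L+1) >= K makes the steps
    accumulated in one block of order eta. *)

Definition frob m n (A : 'M[R]_(m, n)) : R := \sum_i \sum_j A i j ^+ 2.

Lemma frob_ge0 m n (A : 'M[R]_(m, n)) : 0 <= frob A.
Proof. by apply: sumr_ge0 => i _; apply: sumr_ge0 => j _; exact: sqr_ge0. Qed.

Lemma frob_tr m n (A : 'M[R]_(m, n)) : frob A = \tr (A^T *m A).
Proof.
rewrite /frob exchange_big /=; apply: eq_bigr => j _.
by rewrite mxE; apply: eq_bigr => i _; rewrite !mxE expr2.
Qed.

Lemma frob_young m n (A B : 'M[R]_(m, n)) (t : R) : 0 < t ->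
  frob (A - B) <= (1 + t) * frob A + (1 + t^-1) * frob B.
Proof.
move=> t0; rewrite /frob !mulr_sumr -big_split /=; apply: ler_sum => i _.
rewrite !mulr_sumr -big_split /=; apply: ler_sum => j _; rewrite !mxE.
set a := A i j; set b := B i j.
have -> : (1 + t) * a ^+ 2 + (1 + t^-1) * b ^+ 2 =
   (a - b) ^+ 2 + t * (a + t^-1 * b) ^+ 2 by field; lra.
by rewrite lerDl mulr_ge0 ?sqr_ge0// ltW.
Qed.

Lemma frobZ m n (A : 'M[R]_(m, n)) (a : R) : frob (a *: A) = a ^+ 2 * frob A.
Proof.
rewrite /frob mulr_sumr; apply: eq_bigr => i _.
by rewrite mulr_sumr; apply: eq_bigr => j _; rewrite mxE exprMn.
Qed.

Lemma norm2_frob n (v : 'cV[R]_n) : norm2 v ^+ 2 = frob v.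
Proof.
rewrite /norm2 sqr_sqrtr; last by apply: sumr_ge0 => i _; exact: sqr_ge0.
by apply: eq_bigr => i _; rewrite big_ord1.
Qed.

Lemma norm2_ge0 n (v : 'cV[R]_n) : 0 <= norm2 v.
Proof. exact: sqrtr_ge0. Qed.

Lemma norm2Z n (v : 'cV[R]_n) (a : R) : 0 <= a -> norm2 (a *: v) = a * norm2 v.
Proof.
move=> a0; apply/eqP; rewrite -(@eqrXn2 _ 2%N)// ?norm2_ge0//.
  by rewrite exprMn !norm2_frob frobZ.
by rewrite mulr_ge0// norm2_ge0.
Qed.

Lemma norm2_0 n : norm2 (0 : 'cV[R]_n) = 0.
Proof. by rewrite -[X in norm2 X](scale0r 0) norm2Z// mul0r. Qed.

Lemma norm2_eq0 n (v : 'cV[R]_n) : norm2 v = 0 -> v = 0.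
Proof.
move=> v0; have /eqP := norm2_frob v; rewrite v0 expr0n /= eq_sym psumr_eq0.
  move=> /allP h; apply/colP => i; rewrite mxE; apply/eqP.
  by have := h i (mem_index_enum i); rewrite /= big_ord1 sqrf_eq0.
by move=> i _; rewrite big_ord1 sqr_ge0.
Qed.

(** [sup] is meaningful only on a nonempty bounded set. A crude bound is enough: the coordinates of
    x are at most 1 in absolute value, so those of A x are at most the sum of all |A i j|. *)
Lemma spectral_norm_ubound m n (A : 'M[R]_(m, n)) :
  has_sup [set norm2 (A *m x) | x in [set x : 'cV[R]_n | norm2 x <= 1]].
Proof.
split; first by exists (norm2 (A *m 0)); exists 0; rewrite //= norm2_0.
pose c := \sum_(i < m) \sum_(j < n) `|A i j|.
exists (Num.sqrt (\sum_(i < m) c ^+ 2)) => _ [x /= x1 <-].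
have xi i : `|x i 0| <= 1.
  rewrite -(@ler_pXn2r _ 2)// ?nnegrE// ?expr1n real_normK ?num_real//.
  have : frob x <= 1 by rewrite -norm2_frob exprn_ile1// norm2_ge0.
  apply: le_trans; rewrite /frob (bigD1 i)//= big_ord1 lerDl.
  by apply: sumr_ge0 => k _; rewrite big_ord1 sqr_ge0.
rewrite /norm2 ler_sqrt; last by apply: sumr_ge0 => i _; exact: sqr_ge0.
apply: ler_sum => i _; rewrite -[leLHS]real_normK ?num_real//.
have c0 : 0 <= c by apply: sumr_ge0 => k _; apply: sumr_ge0.
rewrite ler_pXn2r ?nnegrE//.
rewrite mxE /c (bigD1 i)//=; apply: le_trans (ler_norm_sum _ _ _) _.
apply: ler_wpDr; first by apply: sumr_ge0 => k _; apply: sumr_ge0.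
by apply: ler_sum => j _; rewrite normrM ler_piMr.
Qed.

Lemma spectral_norm_le m n (A : 'M[R]_(m, n)) (x : 'cV[R]_n) :
  norm2 (A *m x) <= spectral_norm A * norm2 x.
Proof.
have [x0|x0] := eqVneq (norm2 x) 0.
  by rewrite (norm2_eq0 x0) mulmx0 !norm2_0 mulr0.
have xp : 0 < norm2 x by rewrite lt_def x0 norm2_ge0.
rewrite -ler_pdivrMr// mulrC -norm2Z ?invr_ge0 ?norm2_ge0//.
apply: (ub_le_sup (proj2 (spectral_norm_ubound A))).
exists ((norm2 x)^-1 *: x); last by rewrite -scalemxAr.
by rewrite /= norm2Z ?invr_ge0 ?norm2_ge0// mulVf.
Qed.

Lemma frob_col m n (B : 'M[R]_(m, n)) : frob B = \sum_j frob (col j B).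
Proof.
rewrite /frob exchange_big /=; apply: eq_bigr => j _.
by apply: eq_bigr => i _; rewrite big_ord1 mxE.
Qed.

(* [2 v.(Mv) <= c |v|^2 + |Mv|^2 / c] spares the Cauchy-Schwarz inequality. *)
Lemma spectral_norm_quad m n (M : 'M[R]_m) (B : 'M[R]_(m, n)) (c : R) :
  0 < c -> spectral_norm M <= c -> \tr (B^T *m M *m B) <= c * frob B.
Proof.
move=> c0 Mc.
have trE : \tr (B^T *m M *m B) = \sum_j \sum_i col j B i 0 * (M *m col j B) i 0.
  apply: eq_bigr => j _; rewrite -mulmxA mxE; apply: eq_bigr => i _.
  by rewrite !mxE; congr (_ * _); apply: eq_bigr => k _; rewrite !mxE.
rewrite trE frob_col mulr_sumr; apply: ler_sum => j _.
set v := col j B.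
have Mv : frob (M *m v) <= c ^+ 2 * frob v.
  rewrite -!norm2_frob -exprMn ler_pXn2r ?nnegrE ?norm2_ge0//.
    by apply: le_trans (spectral_norm_le _ _) _; rewrite ler_wpM2r ?norm2_ge0.
  by rewrite mulr_ge0 ?norm2_ge0// ltW.
have h : \sum_i v i 0 * (M *m v) i 0 <= (c * frob v + c^-1 * frob (M *m v)) / 2.
  rewrite /frob !mulr_sumr -big_split mulr_suml /=; apply: ler_sum => i _.
  rewrite !big_ord1; set a := v i 0; set b := (M *m v) i 0.
  have -> : (c * a ^+ 2 + c^-1 * b ^+ 2) / 2 = a * b + c * (a - c^-1 * b) ^+ 2 / 2.
    by field; lra.
  rewrite lerDl; apply: mulr_ge0 => //.
  by apply: mulr_ge0 (sqr_ge0 _); exact: ltW.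
apply: (le_trans h).
have : c^-1 * frob (M *m v) <= c^-1 * (c ^+ 2 * frob v).
  by rewrite ler_wpM2l// invr_ge0 ltW.
have -> : c^-1 * (c ^+ 2 * frob v) = c * frob v by field; lra.
lra.
Qed.

Section Averaging.
Context {N : nat}.
Hypothesis N0 : (0 < N)%N.
Local Notation J := (avg_mx R N).

Lemma avg_mxM : J *m J = J.
Proof.
apply/matrixP => i j; rewrite !mxE.
under eq_bigr do rewrite !mxE.
rewrite sumr_const card_ord -[_ *+ N]mulr_natr mulfVK//.
by rewrite pnatr_eq0 -lt0n.
Qed.

Lemma tr_avg_mx : J^T = J.
Proof. by apply/matrixP => i j; rewrite !mxE. Qed.

(** [J] and [1 - J] are complementary orthogonal projections, so this is Pythagoras. *)
Lemma frob_center d (A : 'M[R]_(N, d)) : frob ((1%:M - J) *m A) <= frob A.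
Proof.
suff -> : frob ((1%:M - J) *m A) = frob A - frob (J *m A).
  by rewrite gerBl frob_ge0.
have frobP (C : 'M[R]_N) : C^T = C -> C *m C = C ->
    frob (C *m A) = \tr (A^T *m C *m A).
  by move=> CT CC; rewrite frob_tr trmx_mul CT -!mulmxA (mulmxA C C) CC.
have JC : (1%:M - J)^T = 1%:M - J by rewrite linearB /= trmx1 tr_avg_mx.
have JJ : (1%:M - J) *m (1%:M - J) = 1%:M - J.
  by rewrite mulmxBl mul1mx mulmxBr mulmx1 avg_mxM subrr subr0.
rewrite (frobP _ JC JJ) (frobP _ tr_avg_mx avg_mxM) frob_tr -linearB /=.
by rewrite mulmxBr mulmx1 mulmxBl.
Qed.

Variable W : 'M[R]_N.
Hypothesis dsW : doubly_stochastic W.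

Lemma doubly_stochastic_mul_avg : W *m J = J.
Proof.
case: dsW => _ W1 _; apply/matrixP => i j.
have /matrixP/(_ i 0) := W1; rewrite !mxE.
under eq_bigr do rewrite mxE mulr1; move=> h.
by under eq_bigr do rewrite mxE; rewrite -mulr_suml h mul1r.
Qed.

Lemma avg_mul_doubly_stochastic : J *m W = J.
Proof.
case: dsW => _ _ W1; apply/matrixP => i j.
have /matrixP/(_ 0 j) := W1; rewrite !mxE.
under eq_bigr do rewrite mxE mul1r; move=> h.
by under eq_bigr do rewrite mxE; rewrite -mulr_sumr h mulr1.
Qed.

Lemma doubly_stochastic_le1 i j : W i j <= 1.
Proof.
case: dsW => W0 W1 _; have /matrixP/(_ i 0) := W1; rewrite !mxE.
under eq_bigr do rewrite mxE mulr1; move=> <-.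
by rewrite (bigD1 j)//= lerDl sumr_ge0.
Qed.

(** Since W preserves averages on both sides, (1 - J) W C = (W - J) (1 - J) C and (W - J)^T (W - J)
    = W^T W - J. Written over entries, the trace is linear in those of W^T W, so that the
    expectation can be taken entry by entry. *)
Lemma frob_mix_center d (C : 'M[R]_(N, d)) :
  let B := (1%:M - J) *m C in
  frob ((1%:M - J) *m (W *m C)) =
  \sum_i \sum_j (W^T *m W - J) i j * (B *m B^T) i j.
Proof.
move=> B.
have JT : W^T *m J = J.
  by rewrite -{1}tr_avg_mx -trmx_mul avg_mul_doubly_stochastic tr_avg_mx.
have -> : (1%:M - J) *m (W *m C) = (W - J) *m B.
  rewrite /B !mulmxA; congr (_ *m C).
  rewrite mulmxBl mul1mx mulmxBr mulmx1 mulmxBl avg_mul_doubly_stochastic.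
  by rewrite doubly_stochastic_mul_avg avg_mxM subrr subr0.
rewrite frob_tr trmx_mul linearB /= tr_avg_mx mulmxA -(mulmxA B^T).
have -> : (W^T - J) *m (W - J) = W^T *m W - J.
  by rewrite mulmxBl !mulmxBr JT avg_mul_doubly_stochastic avg_mxM subrr subr0.
rewrite -mulmxA mxtrace_mulC -mulmxA; apply: eq_bigr => i _; rewrite mxE.
apply: eq_bigr => j _; congr (_ * _).
by rewrite !mxE; apply: eq_bigr => k _; rewrite !mxE mulrC.
Qed.

End Averaging.

(** Up to the indexing by pairs, the Kronecker product of I - J with I_d acts on a stacked vector as
    I - J acts on the N by d matrix with one row per agent. In that form W_n acts by plain
    multiplication. *)
Lemma norm2_disagreement N d (th : 'I_N -> 'cV[R]_d) :
  norm2 (disagreement_mx R N d *m stack th) ^+ 2 =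
  frob ((1%:M - avg_mx R N) *m \matrix_(i < N, k < d) th i k ord0).
Proof.
rewrite norm2_frob /frob.
under eq_bigr do rewrite big_ord1.
rewrite pair_big /= (reindex (@mxtens_index N d)) /=; last first.
  by exists (@mxtens_unindex N d) => i _; [exact: mxtens_indexK|exact: mxtens_unindexK].
apply: eq_bigr => -[i k] _ /=; congr (_ ^+ 2); rewrite !mxE.
rewrite (reindex (@mxtens_index N d)) /=; last first.
  by exists (@mxtens_unindex N d) => j _; [exact: mxtens_indexK|exact: mxtens_unindexK].
transitivity (\sum_(p : 'I_N * 'I_d)
   ((1%:M - avg_mx R N) i p.1 * (k == p.2)%:R * th p.1 p.2 ord0)).
  by apply: eq_bigr => -[j l] _; rewrite tensmxE [stack _ _ _]mxE mxtens_indexK /= !mxE.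
rewrite -(pair_bigA _ (fun j l =>
   (1%:M - avg_mx R N) i j * (k == l)%:R * th j l ord0)) /=.
apply: eq_bigr => j _; rewrite (bigD1 k)//= eqxx mulr1 big1 ?addr0 ?mxE//.
by move=> l lk; rewrite [k == l]eq_sym (negbTE lk) mulr0 mul0r.
Qed.

End LinearAlgebra.

(** * Independence and measurability *)

Section Independence.
Context {dT : measure_display} {T : measurableType dT} {R : realType}.
Variable P : probability T R.

(** Two finite measures, [P] restricted to B and [P] scaled by P(B), agree on a pi-system and hence
    on the sigma-algebra it generates. *)
Lemma independent_pi_system (G : set (set T)) (B : set T) :
  G `<=` measurable -> setI_closed G -> G setT -> measurable B ->
  (forall A, G A -> P (A `&` B) = (P A * P B)%E) ->
  forall A, <<s G >> A -> P (A `&` B) = (P A * P B)%E.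
Proof.
move=> Gm GI GT mB GB.
have PBfin : P B \is a fin_num by rewrite fin_num_measure.
have PB0 : 0 <= fine (P B) by rewrite fine_ge0.
pose r : {nonneg R} := NngNum PB0.
move=> A sA; rewrite muleC -(fineK PBfin).
apply: (@g_sigma_algebra_measure_unique _ R T G Gm (fun=> setT) _ _
  (mrestr P mB) (mscale r P) GI _ _ A sA) => //=.
- by rewrite bigcup_const.
- by move=> C GC; rewrite /mrestr /= /mscale /= fineK// muleC; exact: GB.
- by move=> _; rewrite /mrestr setTI ltey_eq fin_num_measure.
Qed.

Definition past_sigma (G0 : set (set T)) (H : nat -> set (set T)) (l : nat) :=
  <<s G0 `|` \bigcup_(k in [set k | (k < l)%N]) H k >>.

(** The past is generated by the pi-system of intersections of a data event A0 with events C_k of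
    [H k], k < l. On these, independence of [HW] from the data splits off A0, and mutual
    independence separates B from the C_k. *)
Lemma independent_past (G0 HW : set (set T)) (H : nat -> set (set T)) l :
  sigma_algebra setT G0 -> G0 `<=` measurable ->
  sigma_algebra setT HW -> HW `<=` measurable ->
  (forall k, sigma_algebra setT (H k)) -> (forall k, H k `<=` HW) ->
  independent_sigma P HW G0 -> mutually_independent_sigma P H ->
  forall A B, past_sigma G0 H l A -> H l B -> P (A `&` B) = (P A * P B)%E.
Proof.
move=> sG0 mG0 sHW mHW sH HHW iWG iH A B sA HB.
have sI (G : set (set T)) : sigma_algebra setT G -> setI_closed G.
  move=> sG; rewrite -(sigma_algebra_id sG) => X Y.
  exact: (@measurableI _ (g_sigma_algebraType G)).
have sT (G : set (set T)) : sigma_algebra setT G -> G setT.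
  move=> sG; rewrite -(sigma_algebra_id sG).
  exact: (@measurableT _ (g_sigma_algebraType G)).
pose cap (C : nat -> set T) := \bigcap_(k in [set k | k \in iota 0 l]) C k.
pose Pi := [set X | exists A0 C, [/\ G0 A0, forall k, H k (C k)
  & X = A0 `&` cap C]].
have HWcap (C : nat -> set T) (s : seq nat) : (forall k, H k (C k)) ->
    HW (\bigcap_(k in [set k | k \in s]) C k).
  move=> HC; rewrite -(sigma_algebra_id sHW).
  apply: (@fin_bigcap_measurable _ (g_sigma_algebraType HW)) => [|k _].
    by apply/finite_seqP; exists s.
  by apply: sub_sigma_algebra; exact/HHW/HC.
have PiI : setI_closed Pi.
  move=> _ _ [A0 [C [GA HC ->]]] [A1 [D [GA' HD ->]]].
  exists (A0 `&` A1), (fun k => C k `&` D k); split.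
  - exact: sI.
  - by move=> k; exact: sI.
  - by rewrite /cap bigcapI setIACA.
apply: (@independent_pi_system Pi) => //.
- move=> _ [A0 [C [GA HC ->]]]; apply: measurableI; first exact: mG0.
  exact/mHW/HWcap.
- exists setT, (fun=> setT); split; [exact: sT|by move=> k; exact: sT|].
  by rewrite setTI /cap (bigcapT (fun _ _ => erefl)).
- exact: mHW (HHW _ _ HB).
- move=> _ [A0 [C [GA HC ->]]].
  (* B takes place l of the family, so that mutual independence applies to C_0, ..., C_{l-1}, B at
     once. *)
  pose C' k := if k == l then B else C k.
  have HC' k : H k (C' k) by rewrite /C'; case: eqVneq => [->|].
  have capE : cap C = cap C'.
    rewrite /cap; apply: eq_bigcapr => k /=; rewrite mem_iota /C' => kl.
    by rewrite ltn_eqF.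
  have capB : cap C `&` B = \bigcap_(k in [set k | k \in l :: iota 0 l]) C' k.
    rewrite capE /cap; apply/seteqP; split=> [w [Cw Bw] k /=|w Cw].
      by rewrite inE => /orP[/eqP ->|]; [rewrite /C' eqxx|exact: Cw].
    split=> [k kl|]; first by apply: Cw; rewrite /= inE kl orbT.
    by have := Cw l; rewrite /C' /= eqxx mem_head; exact.
  have PcapB : P (cap C `&` B) = (P (cap C) * P B)%E.
    rewrite capB iH//; last first.
      by rewrite /= iota_uniq mem_iota /= add0n ltnn.
    rewrite big_cons {1}/C' eqxx muleC; congr (_ * _)%E.
    by rewrite capE /cap iH ?iota_uniq.
  have HWB : HW (cap C `&` B) by rewrite capB; exact: HWcap.
  (* Independence from the data is used twice: to split off [A0] in the presence of B, and to join
     it again without B. *)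
  rewrite -setIA setIC iWG// PcapB -muleA (muleC (P B)) muleA; congr (_ * _)%E.
  by rewrite setIC iWG//; exact: HWcap.
- apply: smallest_sub sA; first exact: smallest_sigma_algebra.
  move=> X [GX|[k /= kl HX]]; apply: sub_sigma_algebra.
    exists X, (fun=> setT); split => //; first by move=> k; exact: sT.
    by rewrite /cap (bigcapT (fun _ _ => erefl)) setIT.
  exists setT, (fun j => if j == k then X else setT); split.
  + exact: sT.
  + by move=> j; case: eqVneq => [->//|_]; exact: sT.
  + rewrite setTI /cap; apply/seteqP; split => [x Xx j _|x]; first by case: ifP.
    by move=> /(_ k); rewrite /= eqxx mem_iota; exact.
Qed.

Definition independent_fun (U V : T -> R) :=
  forall A B : set R, measurable A -> measurable B ->
  P (U @^-1` A `&` V @^-1` B) = (P (U @^-1` A) * P (V @^-1` B))%E.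

(** Independence makes the law of (U, V) the product of the two laws; Tonelli's theorem then
    factorises the integral. *)
Lemma ge0_integral_independent (U V : T -> R) :
  measurable_fun setT U -> measurable_fun setT V ->
  (forall w, 0 <= U w) -> (forall w, 0 <= V w) -> independent_fun U V ->
  (\int[P]_w (U w * V w)%:E = \int[P]_w (U w)%:E * \int[P]_w (V w)%:E)%E.
Proof.
move=> mU mV U0 V0 UV.
pose u : {mfun T >-> R} := mfun_Sub (mem_set mU).
pose v : {mfun T >-> R} := mfun_Sub (mem_set mV).
have mUV : measurable_fun setT (fun w => (U w, V w)).
  exact: measurable_fun_pair.
pose uv : {mfun T >-> (R * R)%type} := mfun_Sub (mem_set mUV).
(* The absolute value makes the integrand nonnegative on the whole plane and changes nothing at the
   values of (U, V). *)
pose f (z : R * R) : \bar R := `|z.1 * z.2|%:E.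
have mf : measurable_fun [set: (R * R)%type] f.
  apply/measurable_EFinP; apply: measurableT_comp => //.
  by apply: measurable_funM; [exact: measurable_fst|exact: measurable_snd].
have f0 z : (0 <= f z)%E by rewrite lee_fin.
have mabs : measurable_fun [set: R] (fun x : R => `|x|%:E).
  by apply/measurable_EFinP; exact: normr_measurable.
have abs w : `|U w * V w| = U w * V w by rewrite ger0_norm// mulr_ge0.
transitivity (\int[distribution P uv]_z f z)%E.
  rewrite (ge0_integral_distribution uv mf f0).
  by apply: eq_integral => w _ /=; rewrite /f /= abs.
transitivity (\int[distribution P u \x distribution P v]_z f z)%E.
  apply: eq_measure_integral => A mA _; symmetry.
  apply: (@product_measure_unique _ _ _ _ R (distribution P u) (distribution P v)
    (distribution P uv)) mA.
  move=> A' B' mA' mB'; exact: UV.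
rewrite (fubini_tonelli1 _ mf f0) /fubini_F /=.
transitivity (\int[distribution P u]_x
    (`|x|%:E * \int[distribution P v]_y `|y|%:E))%E.
  apply: eq_integral => x _; rewrite -ge0_integralZl//.
  by apply: eq_integral => y _; rewrite /f /= normrM.
rewrite ge0_integralZr//; last exact: integral_ge0.
rewrite !(ge0_integral_distribution _ mabs)//.
by congr (_ * _)%E; apply: eq_integral => w _ /=; rewrite ger0_norm.
Qed.

Lemma bounded_integrable (U : T -> R) (c : R) :
  measurable_fun setT U -> (forall w, `|U w| <= c) ->
  P.-integrable setT (EFin \o U).
Proof.
move=> mU Uc; apply: measurable_bounded_integrable => //.
  by rewrite ltey_eq fin_num_measure.
by exists c; split; [exact: num_real|move=> x cx w _; exact: le_trans (Uc w) (ltW cx)].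
Qed.

(** V may change sign, but V + c is nonnegative. The product rule for nonnegative functions applies
    to U and V + c, and the term c E[U] cancels. *)
Lemma Rintegral_independent (U V : T -> R) (c : R) :
  measurable_fun setT U -> measurable_fun setT V ->
  (forall w, 0 <= U w <= c) -> (forall w, `|V w| <= c) -> independent_fun U V ->
  \int[P]_w (U w * V w) = \int[P]_w U w * \int[P]_w V w.
Proof.
move=> mU mV Uc Vc UV.
have U0 w : 0 <= U w by case/andP: (Uc w).
have Uc' w : `|U w| <= c by rewrite ger0_norm//; case/andP: (Uc w).
have iU := bounded_integrable mU Uc'; have iV := bounded_integrable mV Vc.
have UVc w : `|U w * V w| <= c * c by rewrite normrM ler_pM.
have iUV := bounded_integrable (measurable_funM mU mV) UVc.
have mVc : measurable_fun setT (fun w => V w + c).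
  by apply: measurable_funD => //; exact: measurable_cst.
have V0 w : 0 <= V w + c by have := Vc w; rewrite ler_norml; lra.
have icst : P.-integrable setT (EFin \o cst c).
  by apply: (@bounded_integrable _ `|c|) => //; exact: measurable_cst.
have indep : independent_fun U (fun w => V w + c).
  move=> A B mA mB.
  have -> : (fun w => V w + c) @^-1` B = V @^-1` ((fun x => x + c) @^-1` B) by [].
  apply: UV => //; rewrite -[X in measurable X]setTI.
  have mc : measurable_fun [set: R] (fun x : R => x + c).
    by apply: measurable_funD; [exact: measurable_id|exact: measurable_cst].
  exact: mc.
have : \int[P]_w (U w * (V w + c)) = \int[P]_w U w * \int[P]_w (V w + c).
  rewrite /Rintegral ge0_integral_independent// fineM//.
    exact: integrable_fin_num.
  have iVc : P.-integrable setT (EFin \o (fun w => V w + c)).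
    apply: (@bounded_integrable _ (c + c)) => // w.
    by rewrite ger0_norm// lerD2r (le_trans (ler_norm _)).
  exact: integrable_fin_num.
have cE : \int[P]_w c = c.
  rewrite Rintegral_cst//; set q := fine _.
  by have -> : q = 1 := congr1 fine (probability_setT P); rewrite mulr1.
rewrite RintegralD// cE.
under eq_Rintegral do rewrite mulrDr.
rewrite RintegralD//; last first.
  apply: (@bounded_integrable _ (c * c)) => [|w].
    by apply: measurable_funM => //; exact: measurable_cst.
  by rewrite normrM ler_pM// ger0_norm// (le_trans (normr_ge0 _) (Vc w)).
by rewrite RintegralZr// mulrDr => /addIr.
Qed.

Lemma Rintegral_sum (I : Type) (s : seq I) (F : I -> T -> R) :
  (forall i, P.-integrable setT (EFin \o F i)) ->
  \int[P]_w (\sum_(i <- s) F i w) = \sum_(i <- s) \int[P]_w F i w.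
Proof.
move=> iF; rewrite /Rintegral.
under eq_integral do rewrite -sumEFin.
rewrite integral_sum// sum_fine// => i _.
by apply: integrable_fin_num => //; exact: iF.
Qed.

End Independence.

Section Measurability.
Context {d : measure_display} {T : measurableType d} {R : realType}.

(** Balls of the maximum norm are boxes, whose preimages are finite intersections of coordinate
    events, and an open set is a countable union of such balls with rational centres and radii. *)
Lemma measurable_preimage_open m (f : T -> 'cV[R]_m) (U : set 'cV[R]_m) :
  (forall i, measurable_fun setT (fun w => f w i ord0)) ->
  open U -> measurable (f @^-1` U).
Proof.
move=> mf oU.
pose c (p : 'cV[rat]_m * rat) : 'cV[R]_m := map_mx ratr p.1.
pose F (p : 'cV[rat]_m * rat) := if `[< 0 < (ratr p.2 : R) /\ ball (c p) (ratr p.2) `<=` U >]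
  then f @^-1` (ball (c p) (ratr p.2)) else set0.
have -> : f @^-1` U = \bigcup_p F p.
  apply/seteqP; split=> [w /= Uw|w [p _]]; last first.
    by rewrite /F; case: asboolP => // -[_ pU] /pU.
  have /nbhs_ballP[e /= e0 eU] : nbhs (f w) U by exact: open_nbhs_nbhs.
  (* A ball of radius r < e / 2 whose centre is within r of [f w] stays within e of [f w]. *)
  have /rat_in_itvoo[r] : 0 < e / 2 by rewrite divr_gt0.
  rewrite in_itv /= => /andP[r0 re].
  have /choice[q qP] : forall i, exists q : rat, `|ratr q - f w i ord0| < ratr r.
    move=> i; have /rat_in_itvoo[q] : f w i ord0 - ratr r < f w i ord0 + ratr r.
      by lra.
    rewrite in_itv /= => /andP[h1 h2]; exists q.
    by rewrite ltr_norml; apply/andP; split; lra.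
  have fb : ball (c (\col_i q i, r)) (ratr r) (f w).
    split=> // i j; rewrite ord1 /c !mxE /= -ball_normE /=.
    exact: qP.
  exists (\col_i q i, r) => //; rewrite /F /=.
  case: asboolP => //; case; split => // y yb; apply: eU.
  apply: (@le_ball _ _ _ (ratr r + ratr r)); first by lra.
  by apply: ball_triangle yb; exact: ball_sym.
apply: countable_bigcupT_measurable => // p.
rewrite /F; case: asboolP => [[r0 _]|_]; last exact: measurable0.
have -> : f @^-1` ball (c p) (ratr p.2) = \bigcap_(i in [set: 'I_m])
    ((fun w => f w i ord0) @^-1` ball (c p i ord0) (ratr p.2)).
  apply/seteqP; split=> [w [_ h] i _|w h]; first exact: h.
  by split=> // i j; rewrite ord1; exact: h.
apply: fin_bigcap_measurable => // i _.
rewrite -[X in measurable X]setTI; apply: mf => //; exact: measurable_ball.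
Qed.

Lemma measurable_continuous_comp m (f : T -> 'cV[R]_m) (g : 'cV[R]_m -> R) :
  (forall i, measurable_fun setT (fun w => f w i ord0)) -> continuous g ->
  measurable_fun setT (g \o f).
Proof.
move=> mf cg; apply: (measurability _ (RGenOInfty.measurableE R)) => _ [_ [x ->] <-].
rewrite setTI comp_preimage; apply: measurable_preimage_open => //.
by apply: open_comp => // y _; exact: cg.
Qed.

(** As X has finitely many values, this is a finite sum of products with indicators of {X = x}. It
    is applied to the gradient at a random sample. *)
Lemma measurable_finite_choice (S : finType) (X : T -> S) (g : S -> T -> R) :
  (forall x, measurable (X @^-1` [set x])) ->
  (forall x, measurable_fun setT (g x)) ->
  measurable_fun setT (fun w => g (X w) w).
Proof.
move=> mX mg.
have -> : (fun w => g (X w) w) =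
    (fun w => \sum_(x : S) \1_(X @^-1` [set x]) w * g x w).
  apply/funext => w; rewrite (bigD1 (X w))//= big1 ?addr0.
    by rewrite indicE mem_set// mul1r.
  move=> x xX; rewrite indicE memNset ?mul0r//= => Xx.
  by rewrite Xx eqxx in xX.
by apply: measurable_sum => x; apply: measurable_funM.
Qed.

Lemma measurable_mulmx m n p (A : T -> 'M[R]_(m, n)) (B : T -> 'M[R]_(n, p)) i j :
  (forall i k, measurable_fun setT (fun w => A w i k)) ->
  (forall k j, measurable_fun setT (fun w => B w k j)) ->
  measurable_fun setT (fun w => (A w *m B w) i j).
Proof.
move=> mA mB; apply: (eq_measurable_fun (fun w => \sum_k A w i k * B w k j)).
  by move=> w _; rewrite mxE.
by apply: measurable_sum => k; exact: measurable_funM.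
Qed.

Lemma measurable_trmx m n (A : T -> 'M[R]_(m, n)) i j :
  (forall i k, measurable_fun setT (fun w => A w i k)) ->
  measurable_fun setT (fun w => (A w)^T i j).
Proof.
move=> mA; apply: (eq_measurable_fun (fun w => A w j i)) => // w _.
by rewrite mxE.
Qed.

Lemma measurable_frob m n (A : T -> 'M[R]_(m, n)) :
  (forall i k, measurable_fun setT (fun w => A w i k)) ->
  measurable_fun setT (fun w => frob (A w)).
Proof.
move=> mA; apply: measurable_sum => i; apply: measurable_sum => j.
exact: measurable_funX.
Qed.

End Measurability.

(** * The deterministic recursion over communication blocks *)

Section StepRecursion.
Context {R : realType}.
Variables (K : nat -> nat) (Kpos : forall m, (0 < m)%N -> (0 < K m)%N).

Lemma agg_timeS l : agg_time K l.+1 = (agg_time K l + K l.+1)%N.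
Proof. by rewrite /agg_time big_nat_recr. Qed.

Lemma agg_time0 : agg_time K 0 = 0%N.
Proof. by rewrite /agg_time big_geq. Qed.

Lemma agg_time_ltS l : (agg_time K l < agg_time K l.+1)%N.
Proof. by rewrite agg_timeS -addn1 leq_add2l Kpos. Qed.

Lemma agg_time_mono k l : (k <= l)%N -> (agg_time K k <= agg_time K l)%N.
Proof.
move=> kl; rewrite -(subnKC kl); elim: (l - k)%N => [|m IH]; first by rewrite addn0.
by rewrite addnS (leq_trans IH)// ltnW// agg_time_ltS.
Qed.

Lemma agg_time_ge l : (l <= agg_time K l)%N.
Proof. by elim: l => // l IH; exact: leq_ltn_trans IH (agg_time_ltS l). Qed.

Lemma tau_unique n l : (agg_time K l < n)%N -> (n <= agg_time K l.+1)%N ->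
  tau Kpos n = l.+1.
Proof.
move=> ln nl; rewrite /tau; case: ex_minnP => m /andP[m0 nm] minm.
apply/eqP; rewrite eqn_leq minm ?nl//= ltnNge; apply/negP => ml.
by have := leq_trans nm (agg_time_mono ml); rewrite leqNgt ln.
Qed.

Lemma agg_block n : (0 < n)%N -> exists2 l,
  (agg_time K l < n)%N & (n <= agg_time K l.+1)%N.
Proof.
move=> n0; have [m nm minm] := ex_minnP (agg_time_unbounded Kpos n).
case: m nm minm => [//|m] /andP[_ nm] minm; exists m => //.
case: m nm minm => [|m] nm minm; first by rewrite agg_time0.
rewrite ltnNge; apply/negP => h.
by have := minm m.+1; rewrite h /= ltnn => /(_ isT).
Qed.

Variables (gamma s x : nat -> R) (c g r C0 : R) (l0 : nat).
Hypothesis c0 : 0 < c.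
Hypothesis g0 : 0 < g.
Hypothesis C00 : 0 < C0.
Hypothesis r0 : 0 < r.
Hypothesis cr1 : c * r < 1.
Hypothesis x_gt0 : forall n, 0 < x n.
Hypothesis s_gt0 : forall n, (0 < n)%N -> 0 < s n.
Hypothesis gamma_ge0 : forall n, (0 < n)%N -> 0 <= gamma n.
Hypothesis x_agg : forall l, x (agg_time K l.+1).+1 =
  c * (x (agg_time K l.+1) + g * gamma (agg_time K l.+1).+1).
Hypothesis x_step : forall n, (forall l, (0 < l)%N -> n <> agg_time K l) ->
  x n.+1 = x n + g * gamma n.+1.
Local Notation t l := (agg_time K l).+1.
Hypothesis gamma_block : forall l m, (l0 <= l)%N -> (t l <= m)%N ->
  gamma m <= gamma (t l).
Hypothesis gamma_s : forall l, (l0 <= l)%N ->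
  (K l.+1)%:R * gamma (t l) <= C0 * s (t l).
Hypothesis s_ratio : forall l, (l0 <= l)%N -> s (t l) <= r * s (t l.+1).
Hypothesis s_block : forall l n, (l0 <= l)%N -> (agg_time K l < n)%N ->
  (n <= agg_time K l.+1)%N -> s (t l) <= C0 * s n.+1.

(** [t l] is the first index after the l-th aggregation. Until the next one x only grows additively,
    and the step sizes are at most the one at the start of the block. *)
Lemma step_in_block l m : (l0 <= l)%N -> (t l + m <= agg_time K l.+1)%N ->
  x (t l + m)%N <= x (t l) + m%:R * (g * gamma (t l)).
Proof.
move=> ll; elim: m => [|m IH] hm; first by rewrite addn0 mul0r addr0.
have tm : (t l + m < agg_time K l.+1)%N by rewrite -addnS.
rewrite addnS x_step.
  have := IH (ltnW tm); have := @gamma_block l (t l + m).+1 ll.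
  rewrite -natr1 => /(_ _) h h'.
  have {}h : gamma (t l + m).+1 <= gamma (t l) by apply: h; lia.
  have : g * gamma (t l + m).+1 <= g * gamma (t l) by rewrite ler_pM2l.
  lra.
move=> k k0 hk.
have [kl|lk] := leqP k l.
  by have := agg_time_mono kl; rewrite -hk; lia.
by have := agg_time_mono lk; rewrite -hk; lia.
Qed.

(** A block consists of K_{l+1} steps, all but the last without mixing. Together they add at most g
    K_{l+1} gamma, with gamma taken at [t l], and the factor c of the last step acts on the whole
    sum. *)
Lemma step_across l : (l0 <= l)%N ->
  x (t l.+1) <= c * (x (t l) + C0 * g * s (t l)).
Proof.
move=> ll; rewrite x_agg ler_pM2l//.
have K1 := Kpos (ltn0Sn l).
have e : agg_time K l.+1 = (t l + (K l.+1).-1)%N.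
  by rewrite agg_timeS; lia.
have := @step_in_block l (K l.+1).-1 ll; rewrite -e leqnn => /(_ isT).
have h1 : gamma (agg_time K l.+1).+1 <= gamma (t l).
  by apply: gamma_block => //; rewrite ltnS ltnW// agg_time_ltS.
have h2 := gamma_s ll.
have : g * gamma (agg_time K l.+1).+1 <= g * gamma (t l) by rewrite ler_pM2l.
have : g * ((K l.+1)%:R * gamma (t l)) <= g * (C0 * s (t l)) by rewrite ler_pM2l.
rewrite -{1}(prednK K1) -natr1.
lra.
Qed.

Lemma step_recursion_bound : exists2 C, 0 < C & forall n, x n <= C * s n.+1.
Proof.
have [C1 C1p C1P] : exists2 C, 0 < C & forall l, (l0 <= l)%N -> x (t l) <= C * s (t l).
  (* [A] solves A = c r (A + C0 g), so any constant C >= A is preserved from block to block. The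
     second summand of [C] covers the block [l0]. *)
  pose A := c * r * C0 * g / (1 - c * r).
  have A0 : 0 < A by rewrite /A divr_gt0 ?subr_gt0// !mulr_gt0.
  have sl0 := @s_gt0 (t l0) isT.
  exists (A + x (t l0) / s (t l0)).
    by rewrite addr_gt0// divr_gt0.
  set C := A + _.
  have C0' : 0 < C by rewrite addr_gt0// divr_gt0.
  move=> l ll; rewrite -(subnKC ll); elim: (l - l0)%N => [|m IH].
    rewrite addn0 mulrDl divfK ?gt_eqF// lerDr mulr_ge0 ?ltW//.
  rewrite addnS; set k := (l0 + m)%N in IH *.
  have lk : (l0 <= k)%N by rewrite leq_addr.
  apply: (le_trans (step_across lk)).
  have h : x (t k) + C0 * g * s (t k) <= (C + C0 * g) * s (t k).
    by rewrite mulrDl lerD2r.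
  have h1 : c * (x (t k) + C0 * g * s (t k)) <= c * ((C + C0 * g) * s (t k)).
    by rewrite ler_pM2l.
  have h2 : c * (C + C0 * g) * s (t k) <= c * (C + C0 * g) * (r * s (t k.+1)).
    rewrite ler_pM2l; first exact: s_ratio.
    by rewrite mulr_gt0// addr_gt0// mulr_gt0.
  apply: (le_trans h1); rewrite mulrA; apply: (le_trans h2).
  rewrite mulrA ler_pM2r ?s_gt0//.
  have : c * r * C0 * g = A * (1 - c * r) by rewrite /A divfK// gt_eqF// subr_gt0.
  have : 0 <= (C - A) * (1 - c * r).
    by rewrite mulr_ge0 ?subr_ge0 ?(ltW cr1)// /C lerDl divr_ge0 ?ltW.
  nra.
have late n : (agg_time K l0 < n)%N -> x n <= (C1 + g * C0) * C0 * s n.+1.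
  move=> ln; have [l lln nl] := agg_block (leq_ltn_trans (leq0n _) ln).
  have ll : (l0 <= l)%N.
    rewrite leqNgt; apply/negP => /agg_time_mono h.
    by have := leq_ltn_trans nl (leq_ltn_trans h ln); rewrite ltnn.
  have [m mE] : exists m, n = (t l + m)%N by exists (n - t l)%N; lia.
  have h1 : x n <= x (t l) + m%:R * (g * gamma (t l)).
    by rewrite mE; apply: step_in_block => //; rewrite -mE.
  have h2 : m%:R * (g * gamma (t l)) <= g * (C0 * s (t l)).
    rewrite mulrCA ler_pM2l//; apply: le_trans (gamma_s ll).
    rewrite ler_wpM2r ?gamma_ge0// ler_nat.
    by move: nl; rewrite mE agg_timeS; lia.
  apply: (@le_trans _ _ ((C1 + g * C0) * s (t l))).
    by have := C1P _ ll; lra.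
  rewrite -mulrA ler_pM2l; first exact: s_block.
  by rewrite addr_gt0// mulr_gt0.
pose D := (C1 + g * C0) * C0.
have D0 : 0 < D by rewrite mulr_gt0// addr_gt0// mulr_gt0.
(* The finitely many indices up to the aggregation [l0] are absorbed by adding all their ratios. *)
exists (D + \sum_(i < (agg_time K l0).+1) x i / s i.+1).
  by rewrite ltr_wpDr//; apply: sumr_ge0 => i _; rewrite divr_ge0 ?ltW// s_gt0.
move=> n; have sn := @s_gt0 n.+1 isT.
have S0 (Q : pred _) : 0 <= \sum_(i < (agg_time K l0).+1 | Q i) x i / s i.+1.
  by apply: sumr_ge0 => i _; rewrite divr_ge0 ?ltW// s_gt0.
have [nl|ln] := leqP n (agg_time K l0).
  rewrite (bigD1 (Ordinal (nl : (n < (agg_time K l0).+1)%N)))//=.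
  rewrite addrCA mulrDl divfK ?gt_eqF// lerDl mulr_ge0 ?ltW//.
  by rewrite ltr_pwDl.
by apply: le_trans (late _ ln) _; rewrite ler_pM2r// lerDl.
Qed.

End StepRecursion.

(** * Slow variation of the step sizes *)

Section StepSizes.
Context {R : realType}.
Variable K : nat -> nat.
Variables (gamma : nat -> R) (a : R).
Hypothesis a0 : 0 <= a.
Hypothesis a1 : a <= 1.
Hypothesis gammaE : forall n, (0 < n)%N -> gamma n = 1 / n%:R `^ a.
Local Notation t l := (agg_time K l).+1.

Lemma power_step_gt0 n : (0 < n)%N -> 0 < gamma n.
Proof. by move=> n0; rewrite gammaE// divr_gt0// powR_gt0// ltr0n. Qed.

Lemma power_step_le m n : (0 < m)%N -> (m <= n)%N -> gamma n <= gamma m.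
Proof.
move=> m0 mn; have n0 := leq_trans m0 mn.
rewrite !gammaE// !mul1r lef_pV2 ?posrE ?powR_gt0 ?ltr0n//.
by apply: ge0_ler_powR; rewrite ?nnegrE ?ler_nat.
Qed.

(** n gamma_n = n^(1 - a) is nondecreasing because a <= 1: the step sizes decay no faster than
    1/n. *)
Lemma power_step_mul_le m n : (0 < m)%N -> (m <= n)%N ->
  m%:R * gamma m <= n%:R * gamma n.
Proof.
move=> m0 mn; have n0 := leq_trans m0 mn.
have E k : (0 < k)%N -> k%:R * gamma k = k%:R `^ (1 - a).
  move=> k0; have kp : (0 : R) < k%:R by rewrite ltr0n.
  have ka : k%:R `^ (1 - a) * k%:R `^ a = k%:R :> R.
    rewrite -powRD; first by rewrite subrK powRr1// ltW.
    by rewrite (gt_eqF kp) implybT.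
  by rewrite gammaE// mul1r -{1}ka mulfK// gt_eqF// powR_gt0.
rewrite !E//; apply: ge0_ler_powR; rewrite ?nnegrE ?ler_nat//.
by rewrite subr_ge0.
Qed.

(** By [power_step_mul_le] the ratio of the step sizes is at most n divided by [t l], and n exceeds
    [t l] by at most K_{l+1}. *)
Lemma power_step_block_le l n (e : R) : (t l <= n)%N -> (n <= t l.+1)%N ->
  (K l.+1)%:R <= e * (t l)%:R -> gamma (t l) <= (1 + e) * gamma n.
Proof.
move=> tn nt Ke; have n0 : (0 < n)%N by exact: leq_trans tn.
have tp : (0 : R) < (t l)%:R by rewrite ltr0n.
rewrite -(ler_pM2l tp); apply: le_trans (power_step_mul_le _ tn) _ => //.
rewrite mulrA ler_pM2r ?power_step_gt0//.
apply: (@le_trans _ _ ((t l)%:R + (K l.+1)%:R)).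
  by rewrite -natrD ler_nat; move: nt; rewrite agg_timeS; lia.
by rewrite mulrDr mulr1 lerD2l mulrC.
Qed.

End StepSizes.

Section Rates.
Context {R : realType}.
Variables (K : nat -> nat) (Kpos : forall m, (0 < m)%N -> (0 < K m)%N).
Variables (gamma : nat -> R).
Local Notation t l := (agg_time K l).+1.

(** What [step_recursion_bound] requires of the step sizes from some block on. The loss r per block
    may exceed 1 as long as the contraction c outweighs it. *)
Definition slowly_varying (s : nat -> R) (c : R) := exists r C0 l0,
  [/\ 0 < r, 0 < C0, c * r < 1 &
   forall l, (l0 <= l)%N ->
   [/\ forall m, (t l <= m)%N -> gamma m <= gamma (t l),
      (K l.+1)%:R * gamma (t l) <= C0 * s (t l),
      s (t l) <= r * s (t l.+1)
    & forall n, (agg_time K l < n)%N -> (n <= agg_time K l.+1)%N ->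
        s (t l) <= C0 * s n.+1]].

Lemma tau_block_start l : tau Kpos (t l) = l.+1.
Proof. by apply: tau_unique => //; exact: agg_time_ltS. Qed.

Lemma ratio_exists (c : R) : 0 < c -> c < 1 -> exists2 e : R, 0 < e & c * (1 + e) < 1.
Proof.
move=> c0 c1; exists ((1 - c) / 2) => //; first by rewrite divr_gt0 ?subr_gt0.
by nra.
Qed.

Lemma bounded_intervals_slowly_varying c : 0 < c -> c < 1 ->
  bounded_intervals Kpos gamma -> slowly_varying gamma c.
Proof.
move=> c0 c1 [[K0 KK0] [a [ha1 ha2 gE]]].
have a0 : 0 <= a by lra.
have Kb l : (K l.+1)%:R <= K0%:R :> R.
  by rewrite ler_nat -(tau_block_start l).
have [e e0 ce] := ratio_exists c0 c1.
have gp := power_step_gt0 gE.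
(* From block [l0] on, [t l] is at least K0 / e, so a block has at most e times as many steps as its
   starting time. *)
pose l0 := Num.truncn (K0%:R / e).
have C00 : (0 : R) < 1 + K0%:R by rewrite ltr_pwDl.
have r0 : 0 < 1 + e by rewrite addr_gt0.
exists (1 + e), (1 + K0%:R), l0; split=> // l ll.
have t1 : (1 : R) <= (t l)%:R by rewrite ler1n.
have K00 : (0 : R) <= K0%:R by [].
have h1 : (K l.+1)%:R <= e * (t l)%:R.
  apply: (le_trans (Kb l)); rewrite mulrC -ler_pdivrMr// ltW//.
  apply: lt_le_trans (truncnS_gt _) _.
  by rewrite ler_nat ltnS (leq_trans ll)// agg_time_ge.
have h2 : (K l.+1)%:R <= K0%:R * (t l)%:R :> R.
  by apply: (le_trans (Kb l)); rewrite ler_peMr.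
split.
- by move=> m; apply: (power_step_le a0 gE).
- by rewrite ler_pM2r ?gp// (le_trans (Kb l))// lerDr.
- apply: (power_step_block_le a0 ha2 gE) => //.
  by rewrite ltnS ltnW// agg_time_ltS.
- by move=> n ln nl; apply: (power_step_block_le a0 ha2 gE) => //; lia.
Qed.

Lemma increasing_intervals_slowly_varying L c : 0 < L -> 0 < c -> c < 1 ->
  increasing_intervals Kpos gamma L ->
  slowly_varying (eff_step Kpos gamma L) c.
Proof.
move=> L0 c0 c1 [_ gE _ oK ratio].
have gE' n : (0 < n)%N -> gamma n = 1 / n%:R `^ 1 by move=> /gE ->; rewrite powRr1.
have [e e0 ce] := ratio_exists c0 c1.
have gp := power_step_gt0 gE'.
set s := eff_step _ _ _ in ratio *.
have sp n : (0 < n)%N -> 0 < s n.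
  move=> n0; rewrite /s /eff_step mulr_gt0 ?gp// powR_gt0// ltr0n Kpos//.
  by rewrite /tau; case: ex_minnP => m /andP[].
have [l1 _ l1P] : \forall l \near \oo, s (t l) / s (t l.+1) < 1 + e.
  by move/cvgr_lt : ratio; apply; rewrite ltrDl.
(* The growth condition with constant 1: eventually K at time n is at most n^(1 / (2 (L + 1))),
   hence at most n. A block is then no longer than its starting time, and gamma loses at most a
   factor 2 within it. *)
have /eqoP/(_ 1 ltr01)[l2 _ l2P] := oK.
have Kt l : (maxn l1 l2 <= l)%N -> (K l.+1)%:R <= 1 * (t l)%:R :> R.
  move=> ll; have l2t : (l2 <= t l)%N.
    rewrite (leq_trans (leq_maxr l1 l2))// (leq_trans ll)//.
    by rewrite (leq_trans (agg_time_ge Kpos l)).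
  have := l2P _ l2t; rewrite /=.
  rewrite tau_block_start !mul1r gE//.
  rewrite ger0_norm// => /le_trans; apply.
  rewrite ger0_norm ?powR_ge0//.
  have t0 : (0 : R) < (t l)%:R by rewrite ltr0n.
  rewrite ?mul1r -powR_inv1 ?(ltW t0)// -powRrM mulN1r opprK.
  rewrite -[leRHS]powRr1 ?(ltW t0)//; apply: ler_powR; first by rewrite ler1n.
  by rewrite ?mul1r invf_le1; lra.
have C00 : 0 < 2 + e by lra.
have r0 : 0 < 1 + e by lra.
exists (1 + e), (2 + e), (maxn l1 l2); split=> // l ll.
have tp : (0 : R) < (t l)%:R by rewrite ltr0n.
have sr : s (t l) <= (1 + e) * s (t l.+1).
  rewrite -ler_pdivrMr ?sp// ltW// l1P//=.
  exact: leq_trans (leq_maxl _ _) ll.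
split.
- by move=> m; apply: (power_step_le ler01 gE').
(* K >= 1 and L > 0 give K <= K^(L+1), hence K gamma <= eta. *)
- apply: (@le_trans _ _ (s (t l))); last by rewrite ler_peMl ?ltW ?sp//; lra.
  rewrite /s /eff_step tau_block_start mulrC ler_pM2l ?gp//.
  have K1 : 1 <= (K l.+1)%:R :> R by rewrite ler1n Kpos.
  by rewrite -[leLHS]powRr1 ?ler0n//; apply: ler_powR => //; lra.
- exact: sr.
(* The normalisation of index n is taken at n + 1. For the last n of the block this falls into the
   next block, where K may differ, and the limit of the ratios is used; for the other n, K is
   unchanged and only gamma varies. The constant 2 + e covers both cases. *)
- move=> n ln nl; have [nE|nE] := eqVneq n (agg_time K l.+1).
    rewrite nE; apply: (le_trans sr); rewrite ler_pM2r ?sp//; lra.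
  have n1l : (n.+1 <= agg_time K l.+1)%N by rewrite ltn_neqAle nE.
  have h : gamma (t l) <= (1 + 1) * gamma n.+1.
    apply: (power_step_block_le ler01 (lexx 1) gE') => //; last exact: Kt.
    by rewrite ltnS ltnW.
  apply: (@le_trans _ _ (2 * s n.+1)); last by rewrite ler_pM2r ?sp//; lra.
  rewrite /s /eff_step tau_block_start (@tau_unique _ Kpos n.+1 l)//.
    by rewrite mulrA ler_pM2r ?powR_gt0 ?ltr0n ?Kpos.
  exact: leq_trans ln (leqnSn n).
Qed.

End Rates.

(** * Contraction in mean square *)

Section Contraction.
Context {dT : measure_display} {T : measurableType dT} {R : realType}.
Variable P : probability T R.
Context {N d : nat}.
Hypothesis N0 : (0 < N)%N.
Local Notation J := (avg_mx R N).

Lemma mulmx_tr_le_frob (B : 'M[R]_(N, d)) i j : `|(B *m B^T) i j| <= frob B.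
Proof.
rewrite mxE; apply: (le_trans (ler_norm_sum _ _ _)).
have row_le k : \sum_l B k l ^+ 2 <= frob B.
  rewrite /frob (bigD1 k)//= lerDl; apply: sumr_ge0 => k' _.
  by apply: sumr_ge0 => l _; exact: sqr_ge0.
suff : \sum_l `|B i l * B^T l j| <= (\sum_l B i l ^+ 2 + \sum_l B j l ^+ 2) / 2.
  by have := row_le i; have := row_le j; lra.
rewrite -big_split mulr_suml /=; apply: ler_sum => l _; rewrite mxE.
set a := B i l; set b := B j l.
by rewrite ler_norml; have := sqr_ge0 (a - b); have := sqr_ge0 (a + b); nra.
Qed.

(* Expanding the squared norm over the entries of [W^T W] reduces the
   independence of matrices to that of scalars. *)
Lemma expected_mixing_contraction (W : T -> 'M[R]_N) (C : T -> 'M[R]_(N, d))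
    (e : T -> R) (b c : R) :
  let B w := (1%:M - J) *m C w in
  (forall w, doubly_stochastic (W w)) ->
  (forall i j, measurable_fun setT (fun w => W w i j)) ->
  (forall i k, measurable_fun setT (fun w => C w i k)) ->
  measurable_fun setT e -> (forall w, 0 <= e w) ->
  (forall w, frob (B w) * e w <= b) ->
  (forall i j, independent_fun P (fun w => ((W w)^T *m W w) i j)
     (fun w => (B w *m (B w)^T) i j * e w)) ->
  0 < c -> spectral_norm (expected_gram P W - J) <= c ->
  (\int[P]_w (frob ((1%:M - J) *m (W w *m C w)) * e w)%:E <=
   c%:E * \int[P]_w (frob (B w) * e w)%:E)%E.
Proof.
move=> B dsW mW mC me e0 Bb ind c0 Mc.
have BE w : B w = (1%:M - J) *m C w by [].
clearbody B.
pose U i j w := ((W w)^T *m W w) i j.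
pose V i j w := (B w *m (B w)^T) i j * e w.
have mB i k : measurable_fun setT (fun w => B w i k).
  under eq_fun do rewrite BE.
  by apply: measurable_mulmx => // *; exact: measurable_cst.
have mBT i k : measurable_fun setT (fun w => (B w)^T i k).
  exact: measurable_trmx.
have mU i j : measurable_fun setT (U i j).
  by apply: measurable_mulmx => // *; exact: measurable_trmx.
have mV i j : measurable_fun setT (V i j).
  by apply: measurable_funM => //; exact: measurable_mulmx.
(* One constant for both factors: the entries of W^T W lie in [0, N], and |V i j| <= b. *)
pose q := Num.max N%:R b.
have UN i j w : 0 <= U i j w <= q.
  rewrite /U mxE; apply/andP; split.
    by apply: sumr_ge0 => k _; rewrite mxE mulr_ge0//; case: (dsW w).
  rewrite /q le_max; apply/orP; left.
  have -> : N%:R = \sum_(k < N) 1 :> R by rewrite sumr_const card_ord.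
  apply: ler_sum => k _; rewrite mxE.
  by apply: mulr_ile1; rewrite ?(doubly_stochastic_le1 (dsW w))//; case: (dsW w).
have Vb i j w : `|V i j w| <= q.
  rewrite /q le_max; apply/orP; right; apply: le_trans (Bb w).
  by rewrite normrM (ger0_norm (e0 w)) ler_wpM2r ?mulmx_tr_le_frob.
have iV i j := bounded_integrable P (mV i j) (Vb i j).
have iUV i j : P.-integrable setT (EFin \o (fun w => U i j w * V i j w)).
  apply: (@bounded_integrable _ _ _ P _ (q * q)); first exact: measurable_funM.
  move=> w; rewrite normrM ler_pM// ger0_norm; by case/andP: (UN i j w).
have iZ (g : T -> R) (M : 'I_N -> 'I_N -> T -> R) :
    (forall i j, P.-integrable setT (EFin \o M i j)) ->
    (forall w, g w = \sum_i \sum_j M i j w) ->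
    (\int[P]_w (g w)%:E = (\sum_i \sum_j \int[P]_w M i j w)%:E)%E.
  move=> iM gE.
  have iR i : P.-integrable setT (EFin \o (fun w => \sum_j M i j w)).
    apply: (eq_integrable measurableT (fun w => \sum_j (M i j w)%:E)%E) => //.
      by move=> w _ /=; rewrite sumEFin.
    by apply: integrable_sum => // j _; exact: iM.
  have ig : P.-integrable setT (EFin \o g).
    apply: (eq_integrable measurableT (fun w => \sum_i (\sum_j M i j w)%:E)%E) => //.
      by move=> w _ /=; rewrite sumEFin gE.
    by apply: integrable_sum => // i _; exact: iR.
  have fg : (\int[P]_w (g w)%:E)%E \is a fin_num.
    by apply: integrable_fin_num ig.
  rewrite -(fineK fg) -/(Rintegral _ _ _); congr (_%:E).
  under eq_Rintegral do rewrite gE.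
  rewrite Rintegral_sum//; apply: eq_bigr => i _.
  by rewrite Rintegral_sum.
pose M := expected_gram P W - J.
have ME i j : M i j = \int[P]_w U i j w - J i j.
  by rewrite /M !mxE unlock.
have iJV i j : P.-integrable setT (EFin \o (fun w => (U i j w - J i j) * V i j w)).
  apply: (eq_integrable measurableT
     (fun w => (U i j w * V i j w)%:E - (J i j)%:E * (V i j w)%:E)%E) => //.
    by move=> w _ /=; rewrite mulrBl EFinB EFinM.
  apply: integrableB => //; first exact: iUV.
  exact: (integrableZl measurableT _ (iV i j)).
have iKV k i j : P.-integrable setT (EFin \o (fun w => k * V i j w)).
  apply: (eq_integrable measurableT (fun w => k%:E * (V i j w)%:E)%E).
    by move=> w _ /=; rewrite EFinM.
  exact: (integrableZl measurableT _ (iV i j)).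
have iMV i j : P.-integrable setT (EFin \o (fun w => M i j * V i j w)).
  exact: iKV.
rewrite (iZ _ (fun i j w => (U i j w - J i j) * V i j w) iJV); last first.
  move=> w; rewrite (frob_mix_center N0 (dsW w)) -BE mulr_suml.
  apply: eq_bigr => i _; rewrite mulr_suml; apply: eq_bigr => j _.
  by rewrite /V /U mulrA; congr (_ * _ * _); rewrite !mxE.
(* Independence replaces each entry of W^T W by its expectation, while J is deterministic: the
   random matrix becomes the fixed matrix [M]. *)
have -> : \sum_i \sum_j \int[P]_w ((U i j w - J i j) * V i j w) =
          \sum_i \sum_j \int[P]_w (M i j * V i j w).
  apply: eq_bigr => i _; apply: eq_bigr => j _.
  rewrite (RintegralZl _ measurableT (iV i j)) ME.
  under eq_Rintegral do rewrite mulrBl.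
  rewrite (RintegralB measurableT (iUV i j) (iKV _ i j)).
  rewrite (RintegralZl _ measurableT (iV i j)).
  by rewrite (Rintegral_independent (mU i j) (mV i j) (UN i j) (Vb i j)
    (ind i j)) mulrBl.
(* Back under a single integral, the quadratic form of [M] is bounded pointwise by the spectral
   norm. *)
have /= <- := iZ (fun w => \sum_i \sum_j M i j * V i j w) _ iMV (fun=> erefl).
have mfB : measurable_fun setT (fun w => frob (B w) * e w).
  by apply: measurable_funM => //; exact: measurable_frob.
have ifB : P.-integrable setT (EFin \o (fun w => frob (B w) * e w)).
  apply: (@bounded_integrable _ _ _ P _ b) => // w.
  by rewrite ger0_norm// mulr_ge0// frob_ge0.
rewrite -integralZl//; apply: le_integral => //.
- have : P.-integrable setT (fun w => \sum_i (\sum_j M i j * V i j w)%:E)%E.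
    apply: integrable_sum => // i _.
    apply: (eq_integrable measurableT (fun w => \sum_j (M i j * V i j w)%:E)%E) => //.
      by move=> w _ /=; rewrite sumEFin.
    by apply: integrable_sum => // j _; exact: iMV.
  by apply: eq_integrable => // w _; rewrite sumEFin.
- exact: (integrableZl measurableT _ ifB).
move=> w _; rewrite -EFinM lee_fin.
have -> : \sum_i \sum_j M i j * V i j w = \tr ((B w)^T *m M *m B w) * e w.
  rewrite -mulmxA mxtrace_mulC -mulmxA /mxtrace mulr_suml.
  apply: eq_bigr => i _; rewrite mxE mulr_suml; apply: eq_bigr => j _.
  rewrite /V mulrA; congr (_ * _ * _).
  by rewrite !mxE; apply: eq_bigr => k _; rewrite !mxE mulrC.
by rewrite mulrA ler_wpM2r// spectral_norm_quad.
Qed.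

End Contraction.

(** * Measurability and bounds for the iterates *)

Lemma lipschitz_coord_continuous (R : realType) d (G : 'cV[R]_d -> 'cV[R]_d)
    (L : R) (k : 'I_d) : 0 < L ->
  (forall t u, norm2 (G t - G u) <= L * norm2 (t - u)) ->
  continuous (fun t => G t k ord0).
Proof.
move=> L0 GL t; apply/(@cvgrPdist_lt _ _ _ (nbhs t) (nbhs_filter t)) => /= e e0.
have d0 : 0 < L * d.+1%:R by rewrite mulr_gt0.
(* The ball is that of the maximum norm. The factor d + 1 exceeds the square root of d, which gives
   a strict Euclidean bound, and it is nonzero also for d = 0. *)
apply/nbhs_ballP; exists (e / (L * d.+1%:R)) => [|u [_ tu]]; first exact: divr_gt0.
have uk i : `|(t - u) i ord0| < e / (L * d.+1%:R).
  by have := tu i ord0; rewrite -ball_normE /= !mxE.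
have -> : G t k ord0 - G u k ord0 = (G t - G u) k ord0 by rewrite !mxE.
have Gk : `|(G t - G u) k ord0| <= norm2 (G t - G u).
  rewrite -(@ler_pXn2r _ 2)// ?nnegrE ?norm2_ge0// norm2_frob real_normK ?num_real//.
  rewrite /frob (bigD1 k)//= big_ord1 lerDl.
  by apply: sumr_ge0 => i _; rewrite big_ord1 sqr_ge0.
apply: (le_lt_trans Gk); apply: (le_lt_trans (GL t u)).
rewrite mulrC -ltr_pdivlMr//.
rewrite -(@ltr_pXn2r _ 2)// ?nnegrE ?norm2_ge0//; last by rewrite divr_ge0 ?ltW.
rewrite norm2_frob; set q := e / L.
have qE : e / (L * d.+1%:R) = q / d.+1%:R by rewrite invfM mulrA.
have q0 : 0 < q by rewrite divr_gt0.
have D1 : (1 : R) <= d.+1%:R by rewrite ler1n.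
apply: (@le_lt_trans _ _ (\sum_(i < d) (q / d.+1%:R) ^+ 2)).
  rewrite /frob; apply: ler_sum => i _; rewrite big_ord1 -qE.
  rewrite -[leLHS]real_normK ?num_real// ler_pXn2r ?nnegrE//.
    exact/ltW/uk.
  by rewrite divr_ge0 ?ltW.
rewrite sumr_const card_ord -[ltLHS]mulr_natr.
have -> : q ^+ 2 = (q / d.+1%:R) ^+ 2 * d.+1%:R ^+ 2.
  by rewrite -exprMn divfK// gt_eqF// ltr0n.
rewrite ltr_pM2l ?exprn_gt0// ?divr_gt0//.
by rewrite expr2 -natrM ltr_nat; lia.
Qed.

Section DsgdMeasurable.
Context {dT : measure_display} {T : measurableType dT} {R : realType}.
Context {N d : nat} {S : 'I_N -> finType}.
Variables (F : forall i : 'I_N, 'cV[R]_d -> S i -> R).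
Variables (X : forall i : 'I_N, nat -> T -> S i) (W : nat -> T -> 'M[R]_N).
Variables (gamma : nat -> R) (theta0 : 'I_N -> 'cV[R]_d).
Hypothesis F_cont : forall i x k,
  continuous (fun t => grad (@F i ^~ x) t k ord0).
Hypothesis mX : forall i m (x : S i), measurable (@X i m @^-1` [set x]).
Local Notation th := (dsgd (@F) (@X) W gamma theta0).

Lemma measurable_dsgd_grad n i k :
  (forall i k, measurable_fun setT (fun w => th n w i k ord0)) ->
  measurable_fun setT
    (fun w => grad (fun t => @F i t (@X i n w)) (th n w i) k ord0).
Proof.
move=> mth.
apply: (@measurable_finite_choice _ _ _ _ (@X i n)
  (fun x w => grad (@F i ^~ x) (th n w i) k ord0)) => // x.
exact: (measurable_continuous_comp (mth i) (@F_cont i x k)).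
Qed.

(** Measurability is asked of W_m for m < n, so that the lemma also applies with the sigma-algebra
    of the past in place of the full one; this shows that the iterate is determined by the past. *)
Lemma measurable_dsgd n :
  (forall m i j, (m < n)%N -> measurable_fun setT (fun w => W m w i j)) ->
  forall i k, measurable_fun setT (fun w => th n w i k ord0).
Proof.
elim: n => [|n IH] mW i k; first exact: measurable_cst.
have {}IH := IH (fun m i j mn => mW m i j (ltnW mn)).
apply: (eq_measurable_fun (fun w => \sum_j W n w i j * (th n w j k ord0 -
    gamma n.+1 * grad (fun t => @F j t (@X j n w)) (th n w j) k ord0))).
  by move=> w _; rewrite /= summxE; apply: eq_bigr => j _; rewrite !mxE.
apply: measurable_sum => j; apply: measurable_funM; first exact: mW.
apply: measurable_funB; first exact: IH.
apply: measurable_funM; first exact: measurable_cst.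
exact: measurable_dsgd_grad.
Qed.

(** Theta_j depends on W_m with m < j, so the event of index n + 1 is already determined before W_n
    is drawn. Closedness of Omega gives measurability through the open complement. *)
Lemma measurable_history (Omega : set 'cV[R]_(N * d)) n : closed Omega ->
  (forall m i j, (m.+1 < n)%N -> measurable_fun setT (fun w => W m w i j)) ->
  measurable (\bigcap_(j in [set j | (j < n)%N])
    ((fun w => stack (th j w)) @^-1` Omega)).
Proof.
move=> cO mW; apply: bigcap_measurableType => j /= jn.
rewrite -(setCK Omega) preimage_setC; apply: measurableC.
apply: (measurable_preimage_open _ (closed_openC cO)).
move=> k; apply: (eq_measurable_fun
  (fun w => th j w (mxtens_unindex k).1 (mxtens_unindex k).2 ord0)).
  by move=> w _; rewrite mxE.
by apply: measurable_dsgd => m i l mj; apply: mW; lia.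
Qed.

Definition dsgd_mx n w : 'M[R]_(N, d) := \matrix_(i, k) th n w i k ord0.

(** The state between the gradient step and the mixing: its disagreement is what W_n contracts. *)
Definition local_step n w : 'M[R]_(N, d) := dsgd_mx n w - gamma n.+1 *:
  \matrix_(i, k) grad (fun t => @F i t (@X i n w)) (th n w i) k ord0.

Lemma dsgd_mxS n w : dsgd_mx n.+1 w = W n w *m local_step n w.
Proof.
apply/matrixP => i k; rewrite !mxE /= summxE; apply: eq_bigr => j _.
by rewrite !mxE.
Qed.

Lemma measurable_dsgd_mx n :
  (forall m i j, (m < n)%N -> measurable_fun setT (fun w => W m w i j)) ->
  forall i k, measurable_fun setT (fun w => dsgd_mx n w i k).
Proof.
move=> mW i k; apply: (eq_measurable_fun (fun w => th n w i k ord0)).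
  by move=> w _; rewrite mxE.
exact: measurable_dsgd.
Qed.

Lemma measurable_local_step n :
  (forall m i j, (m < n)%N -> measurable_fun setT (fun w => W m w i j)) ->
  forall i k, measurable_fun setT (fun w => local_step n w i k).
Proof.
move=> mW i k; apply: (eq_measurable_fun (fun w => th n w i k ord0 -
    gamma n.+1 * grad (fun t => @F i t (@X i n w)) (th n w i) k ord0)).
  by move=> w _; rewrite !mxE.
apply: measurable_funB; first exact: measurable_dsgd.
apply: measurable_funM; first exact: measurable_cst.
by apply: measurable_dsgd_grad => *; exact: measurable_dsgd.
Qed.

End DsgdMeasurable.

Section CompactBounds.
Context {R : realType}.

Lemma compact_stack_bounded N d (Omega : set 'cV[R]_(N * d)) : compact Omega ->
  exists2 M : R, 0 < M & forall th : 'I_N -> 'cV[R]_d, Omega (stack th) ->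
    forall i k, `|th i k ord0| <= M.
Proof.
move=> /compact_bounded[M0 [_ M0P]].
exists (`|M0| + 1 + 1); first by have := normr_ge0 M0; lra.
move=> th Oth i k.
have h : `|stack th| <= `|M0| + 1.
  by apply: M0P => //; rewrite (le_lt_trans (ler_norm _))// ltrDl.
have : ball (0 : 'cV[R]_(N * d)) (`|M0| + 1 + 1) (stack th).
  by rewrite -ball_normE /= sub0r normrN (le_lt_trans h)// ltrDl.
move=> [_ /(_ (mxtens_index (i, k)) ord0)]; rewrite -ball_normE /=.
by rewrite !mxE mxtens_indexK /= sub0r normrN => /ltW.
Qed.

Lemma frob_le m n (A : 'M[R]_(m, n)) (M : R) :
  (forall i j, `|A i j| <= M) -> frob A <= M ^+ 2 * (m * n)%:R.
Proof.
move=> AM; rewrite /frob.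
apply: (@le_trans _ _ (\sum_(i < m) \sum_(j < n) M ^+ 2)).
  apply: ler_sum => i _; apply: ler_sum => j _.
  rewrite -[leLHS]real_normK ?num_real// ler_pXn2r ?nnegrE//.
  by rewrite (le_trans _ (AM i j)).
by rewrite !sumr_const !card_ord -mulrnA mulnC -[leLHS]mulr_natr.
Qed.

(** Finiteness of the data sets bounds all gradients at 0 together, and the Lipschitz condition
    carries the bound to the box of radius M, uniformly in agent and sample. *)
Lemma lipschitz_bounded N d (S : 'I_N -> finType)
    (G : forall i, S i -> 'cV[R]_d -> 'cV[R]_d) (L M : R) :
  (forall i x t u, norm2 (G i x t - G i x u) <= L * norm2 (t - u)) ->
  0 < L ->
  exists2 b : R, 0 < b & forall i x (t : 'cV[R]_d),
    (forall k, `|t k ord0| <= M) -> frob (G i x t) <= b.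
Proof.
move=> GL L0.
pose b0 := \sum_i \sum_(x : S i) frob (G i x 0).
pose b1 := L ^+ 2 * (M ^+ 2 * (d * 1)%:R).
have b00 : 0 <= b0.
  by apply: sumr_ge0 => i _; apply: sumr_ge0 => x _; exact: frob_ge0.
have b10 : 0 <= b1.
  by apply: mulr_ge0 (sqr_ge0 _) _; apply: mulr_ge0 (sqr_ge0 _) _.
exists (2 * b1 + 2 * b0 + 1); first lra.
move=> i x t tM.
have hE : G i x t = (G i x t - G i x 0) - (- G i x 0) by rewrite opprK subrK.
have := frob_young (G i x t - G i x 0) (- G i x 0) ltr01.
rewrite -hE invr1 => h1.
have h0 : frob (- G i x 0) = frob (G i x 0).
  by rewrite -scaleN1r frobZ sqrrN expr1n mul1r.
rewrite h0 in h1.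
have h2 : frob (G i x 0) <= b0.
  rewrite /b0 (bigD1 i)//= (bigD1 x)//= -addrA lerDl addr_ge0//.
    by apply: sumr_ge0 => y _; exact: frob_ge0.
  by apply: sumr_ge0 => j _; apply: sumr_ge0 => y _; exact: frob_ge0.
have h3 : frob (G i x t - G i x 0) <= b1.
  rewrite -norm2_frob; apply: (@le_trans _ _ ((L * norm2 t) ^+ 2)).
    rewrite ler_pXn2r ?nnegrE ?norm2_ge0 ?mulr_ge0 ?norm2_ge0 ?(ltW L0)//.
    by have := GL i x t 0; rewrite subr0.
  rewrite exprMn norm2_frob ler_wpM2l ?sqr_ge0//; apply: frob_le => k j.
  by rewrite ord1.
lra.
Qed.

End CompactBounds.

(** * The second moment recursion *)

Section SecondMoment.
Context {dT : measure_display} {T : measurableType dT} {R : realType}.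
Variable P : probability T R.
Context {N d : nat}.
Hypothesis N0 : (0 < N)%N.
Local Notation center := (1%:M - avg_mx R N).

Lemma integral_probability_cst (r : R) : (\int[P]_w r%:E = r%:E)%E.
Proof.
rewrite integral_cst// -[RHS]mule1; congr (_ * _)%E.
exact: probability_setT.
Qed.

(* Young's inequality with parameter [h g / x] turns the bound [x ^ 2] into
   [(x + h g) ^ 2], as Minkowski's inequality in L^2 would. *)
Lemma integral_young (A G : T -> 'M[R]_(N, d)) (e e' : T -> R) (g x h : R) :
  (forall i k, measurable_fun setT (fun w => A w i k)) ->
  (forall i k, measurable_fun setT (fun w => (A w - h *: G w) i k)) ->
  measurable_fun setT e -> measurable_fun setT e' ->
  (forall w, 0 <= e' w <= e w) ->
  (forall w, frob (G w) * e' w <= g ^+ 2) ->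
  0 < g -> 0 < x -> 0 < h ->
  (\int[P]_w (frob (center *m A w) * e w)%:E <= (x ^+ 2)%:E)%E ->
  (\int[P]_w (frob (center *m (A w - h *: G w)) * e' w)%:E <=
   ((x + g * h) ^+ 2)%:E)%E.
Proof.
move=> mA mAG me me' e'e Gg g0 x0 h0 IA.
pose t := h * g / x.
have t0 : 0 < t by rewrite divr_gt0 ?mulr_gt0.
pose r := (1 + t^-1) * (h ^+ 2 * g ^+ 2).
have r0 : 0 <= r.
  apply: mulr_ge0; first by rewrite addr_ge0 ?invr_ge0 ?ltW.
  by apply: mulr_ge0; exact: sqr_ge0.
have mc (C : T -> 'M[R]_(N, d)) : (forall i k, measurable_fun setT (fun w => C w i k)) ->
    measurable_fun setT (fun w => frob (center *m C w)).
  move=> mC; apply: measurable_frob => i k.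
  by apply: measurable_mulmx => // *; exact: measurable_cst.
have mf : measurable_fun setT (fun w => (frob (center *m A w) * e w)%:E).
  by apply/measurable_EFinP; apply: measurable_funM => //; exact: mc.
have e0 w : 0 <= e w by case/andP: (e'e w) => /le_trans h1 /h1.
have f0 w : (0 <= (frob (center *m A w) * e w)%:E)%E.
  by rewrite lee_fin mulr_ge0 ?frob_ge0.
apply: (@le_trans _ _
  (\int[P]_w ((1 + t)%:E * (frob (center *m A w) * e w)%:E + r%:E))%E).
  apply: ge0_le_integral => //.
  - by move=> w _; rewrite lee_fin mulr_ge0 ?frob_ge0//; case/andP: (e'e w).
  - by apply/measurable_EFinP; apply: measurable_funM => //; exact: mc.
  - by apply: emeasurable_funD; [exact: measurable_funeM|exact: measurable_cst].
  move=> w _; rewrite -EFinM -EFinD lee_fin mulmxBr.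
  have /andP[e'0 e'le] := e'e w.
  have h1 := frob_young (center *m A w) (center *m (h *: G w)) t0.
  have h2 : frob (center *m (h *: G w)) <= h ^+ 2 * frob (G w).
    by rewrite (le_trans (frob_center N0 _))// frobZ.
  have h3 := ler_wpM2r e'0 h1.
  (* As [e' <= e], the assumed bound with [e] takes care of the first term. *)
  have h4 : (1 + t) * frob (center *m A w) * e' w <=
            (1 + t) * (frob (center *m A w) * e w).
    rewrite -mulrA ler_wpM2l ?addr_ge0 ?(ltW t0)//.
    by rewrite ler_wpM2l ?frob_ge0.
  have h5 : (1 + t^-1) * frob (center *m (h *: G w)) * e' w <= r.
    rewrite /r -mulrA ler_wpM2l ?addr_ge0 ?invr_ge0 ?(ltW t0)//.
    apply: (@le_trans _ _ (h ^+ 2 * frob (G w) * e' w)); first exact: ler_wpM2r.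
    by rewrite -mulrA ler_wpM2l ?sqr_ge0.
  by apply: (le_trans h3); rewrite mulrDl lerD.
rewrite ge0_integralD//; last 2 first.
- by move=> w _; rewrite mule_ge0// lee_fin addr_ge0 ?(ltW t0).
- exact: measurable_funeM.
rewrite ge0_integralZl//; last by rewrite lee_fin addr_ge0 ?(ltW t0).
rewrite integral_probability_cst.
apply: (@le_trans _ _ ((1 + t)%:E * (x ^+ 2)%:E + r%:E)%E).
  by rewrite leeD2r// lee_wpmul2l// lee_fin addr_ge0 ?(ltW t0).
rewrite -EFinM -EFinD lee_fin /r /t le_eqVlt; apply/orP; left; apply/eqP.
by field; lra.
Qed.

Context {S : 'I_N -> finType}.
Variables (F : forall i : 'I_N, 'cV[R]_d -> S i -> R).
Variables (X : forall i : 'I_N, nat -> T -> S i) (W : nat -> T -> 'M[R]_N).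
Variables (gamma : nat -> R) (theta0 : 'I_N -> 'cV[R]_d).
Variables (K : nat -> nat) (Kpos : forall m, (0 < m)%N -> (0 < K m)%N).
Variables (L c : R) (Omega : set 'cV[R]_(N * d)).
Hypothesis mX : forall i m (x : S i), measurable (@X i m @^-1` [set x]).
Hypothesis gamma_gt0 : forall n, (0 < n)%N -> 0 < gamma n.
Hypothesis mW : forall n i j, measurable_fun setT (fun w => W n w i j).
Hypothesis W_id : forall n, (forall l, (0 < l)%N -> n <> agg_time K l) ->
  forall w, W n w = 1%:M.
Hypothesis L0 : 0 < L.
Hypothesis F_lip : forall i x t u,
  norm2 (grad (@F i ^~ x) t - grad (@F i ^~ x) u) <= L * norm2 (t - u).
Hypothesis W_data : independent_sigma P (sigma_comm W setT) (sigma_data (@X)).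
Hypothesis dsW : forall n w, doubly_stochastic (W n w).
Hypothesis W_indep : mutually_independent_sigma P
  (fun l => sigma_comm W [set agg_time K l.+1]).
Hypothesis c0 : 0 < c.
Hypothesis W_contract : forall l, (0 < l)%N ->
  spectral_norm (expected_gram P (W (agg_time K l)) - avg_mx R N) <= c ^+ 2.
Hypothesis cpO : compact Omega.

Local Notation th := (dsgd (@F) (@X) W gamma theta0).
Local Notation A := (dsgd_mx (@F) (@X) W gamma theta0).
Local Notation C := (local_step (@F) (@X) W gamma theta0).
Let G n w : 'M[R]_(N, d) :=
  \matrix_(i, k) grad (fun t => @F i t (@X i n w)) (th n w i) k ord0.
Let H n := \bigcap_(j in [set j | (j < n)%N]) ((fun w => stack (th j w)) @^-1` Omega).
Let e n : T -> R := \1_(H n).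

Let F_cont i x k : continuous (fun t => grad (@F i ^~ x) t k ord0).
Proof. exact: lipschitz_coord_continuous L0 (F_lip x). Qed.

Let e_ge0 n w : 0 <= e n w.
Proof. by rewrite /e indicE. Qed.

Let e_le1 n w : e n w <= 1.
Proof. by rewrite /e indicE; case: (_ \in _). Qed.

Let e_anti n w : e n.+1 w <= e n w.
Proof.
rewrite /e !indicE; case: (boolP (w \in H n.+1)) => // /set_mem h.
by rewrite mem_set// => j /= jn; apply: h => /=; exact: leqW.
Qed.

(** The indicator of index n + 1 is the one that forces Theta_n into Omega and so bounds the
    gradients at time n. *)
Let e_mul_le n w (y b : R) : 0 <= b -> (Omega (stack (th n w)) -> y <= b) ->
  y * e n.+1 w <= b.
Proof.
move=> b0 yb; rewrite /e indicE; case: (boolP (w \in _)) => [/set_mem h|_].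
  by rewrite mulr1; apply: yb; exact: (h n (ltnSn n)).
by rewrite mulr0.
Qed.

Let me n : measurable_fun setT (e n).
Proof.
apply: measurable_indic; apply: measurable_history => //.
exact: compact_closed.
Qed.

Let gradient_bound : exists2 g : R, 0 < g &
  forall n w, Omega (stack (th n w)) -> frob (G n w) <= g ^+ 2.
Proof.
have [M M0 OM] := compact_stack_bounded cpO.
have [b b0 Gb] := @lipschitz_bounded _ _ _ _
  (fun i x => grad (@F i ^~ x)) L M F_lip L0.
exists (Num.sqrt (N%:R * b)) => [|n w On].
  by rewrite sqrtr_gt0 mulr_gt0// ltr0n.
rewrite sqr_sqrtr ?mulr_ge0 ?(ltW b0)//.
apply: (@le_trans _ _ (\sum_(i < N) b)); last by rewrite sumr_const card_ord mulr_natl.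
apply: ler_sum => i _; apply: le_trans (Gb i (@X i n w) (th n w i) _).
  by apply: ler_sum => k _; rewrite big_ord1 mxE.
by move=> k; exact: OM.
Qed.

Let state_bound : exists2 b : R, 0 <= b &
  forall n w, Omega (stack (th n w)) -> frob (A n w) <= b.
Proof.
have [M M0 OM] := compact_stack_bounded cpO.
exists (M ^+ 2 * (N * d)%:R); first by rewrite mulr_ge0 ?sqr_ge0.
by move=> n w On; apply: frob_le => i k; rewrite mxE; exact: OM.
Qed.

(** This is for integrability, so the bound may depend on n. *)
Let step_bounded n : exists b : R,
  forall w, frob (center *m C n w) * e n.+1 w <= b.
Proof.
have [g g0 Gg] := gradient_bound; have [b b0 Ab] := state_bound.
pose q := gamma n.+1 ^+ 2 * g ^+ 2.
have q0 : 0 <= q by apply: mulr_ge0; exact: sqr_ge0.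
exists (2 * b + 2 * q) => w; apply: e_mul_le => [|On]; first lra.
apply: (le_trans (frob_center N0 _)).
have := frob_young (A n w) (gamma n.+1 *: G n w) ltr01.
rewrite frobZ invr1 -/(C n w) => h; apply: (le_trans h).
have h1 := Ab _ _ On.
have h2 : gamma n.+1 ^+ 2 * frob (G n w) <= q.
  by rewrite ler_wpM2l ?sqr_ge0// Gg.
lra.
Qed.

(** The second function is determined by the data and the matrices of earlier aggregations, the
    first by W_n alone, so [independent_past] applies. *)
Let independent_step l i j : let n := agg_time K l.+1 in
  independent_fun P (fun w => ((W n w)^T *m W n w) i j)
   (fun w => ((center *m C n w) *m (center *m C n w)^T) i j * e n.+1 w).
Proof.
move=> n D E mD mE.
pose Hs k := sigma_comm W [set agg_time K k.+1].
have comm_sub (D1 : set nat) : sigma_comm W D1 `<=` sigma_comm W setT.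
  apply: smallest_sub; first exact: smallest_sigma_algebra.
  by move=> _ [m [i' [j' [B [_ mB ->]]]]]; apply: sub_sigma_algebra; exists m, i', j', B.
rewrite setIC muleC.
apply: (@independent_past _ _ _ P (sigma_data (@X)) (sigma_comm W setT) Hs l) => //.
- exact: smallest_sigma_algebra.
- apply: smallest_sub; first exact: sigma_algebra_measurable.
  by move=> _ [i' [m [x ->]]]; exact: mX.
- exact: smallest_sigma_algebra.
- apply: smallest_sub; first exact: sigma_algebra_measurable.
  move=> _ [m [i' [j' [B [_ mB ->]]]]]; rewrite -[X in measurable X]setTI.
  exact: mW.
- by move=> k; exact: smallest_sigma_algebra.
- by move=> k; exact: comm_sub.
- set Gen := sigma_data (@X) `|` \bigcup_(k in [set k | (k < l)%N]) Hs k.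
  (* [T'] is the sample space with the sigma-algebra of the past; the measurability lemmas are now
     instantiated at [T']. *)
  pose T' := g_sigma_algebraType Gen.
  have mX' i' m (x : S i') : @measurable _ T' (@X i' m @^-1` [set x]).
    apply: sub_sigma_algebra; left; apply: sub_sigma_algebra.
    by exists i', m, x.
  have mW' m i' j' : (m < n)%N -> measurable_fun [set: T'] (fun w : T' => W m w i' j').
    (* A matrix before time n either comes from one of the first l aggregations or is the
       identity. *)
    move=> mn; have [[k mk]|nk] := pselect (exists k, m = agg_time K k.+1).
      move=> _ B mB; rewrite setTI; apply: sub_sigma_algebra; right.
      exists k => /=.
        rewrite ltnNge; apply/negP => lk.
        have := @agg_time_mono K Kpos l.+1 k.+1 lk.
        by rewrite -mk leqNgt mn.
      by apply: sub_sigma_algebra; exists m, i', j', B; split.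
    apply: (@eq_measurable_fun _ _ T' _ _ (fun=> (1%:M : 'M[R]_N) i' j')).
      move=> w _; rewrite W_id// => -[//|k] _ mk.
      by apply: nk; exists k.
    exact: measurable_cst.
  have mC' i' k : measurable_fun [set: T'] (fun w : T' => C n w i' k).
    by apply: (@measurable_local_step _ T').
  have mB' i' k : measurable_fun [set: T'] (fun w : T' => (center *m C n w) i' k).
    by apply: (@measurable_mulmx _ T') => // *; exact: measurable_cst.
  have me' : measurable_fun [set: T'] (e n.+1 : T' -> R).
    apply: (@measurable_indic _ T'); apply: (@measurable_history _ T') => //.
    exact: compact_closed.
  suff mV : measurable_fun [set: T'] ((fun w =>
      ((center *m C n w) *m (center *m C n w)^T) i j * e n.+1 w) : T' -> R).
    by have := mV measurableT _ mE; rewrite setTI.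
  apply: measurable_funM => //; apply: (@measurable_mulmx _ T') => // *.
  exact: (@measurable_trmx _ T').
- set Gen := [set E | exists n i j (B : set R),
    [/\ [set agg_time K l.+1] n, measurable B & E = (fun w => W n w i j) @^-1` B]].
  pose T' := g_sigma_algebraType Gen.
  have mW' i' j' : measurable_fun [set: T'] (fun w : T' => W n w i' j').
    move=> _ B mB; rewrite setTI; apply: sub_sigma_algebra.
    by exists n, i', j', B.
  suff mU : measurable_fun [set: T'] ((fun w => ((W n w)^T *m W n w) i j) : T' -> R).
    by have := mU measurableT _ mD; rewrite setTI.
  apply: (@measurable_mulmx _ T') => // *.
  exact: (@measurable_trmx _ T').
Qed.

Lemma second_moment_recursion : exists2 g : R, 0 < g & exists x : nat -> R,
  [/\ forall n, 0 < x n,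
      forall l, x (agg_time K l.+1).+1 =
        c * (x (agg_time K l.+1) + g * gamma (agg_time K l.+1).+1),
      forall n, (forall l, (0 < l)%N -> n <> agg_time K l) ->
        x n.+1 = x n + g * gamma n.+1,
      forall n, measurable_fun setT (fun w => frob (center *m A n w) * e n w)
    & forall n, (\int[P]_w (frob (center *m A n w) * e n w)%:E <=
        (x n ^+ 2)%:E)%E].
Proof.
have [g g0 Gg] := gradient_bound.
pose agg n := `[< exists l, n = agg_time K l.+1 >].
pose f0 : R := frob (\matrix_(i < N, k < d) theta0 i k ord0).
(* The start f0 + 1 satisfies (f0 + 1)^2 >= f0 and is positive, as [integral_young] requires of
   x. *)
pose x := fix x n := if n is m.+1
  then (if agg m then c else 1) * (x m + g * gamma m.+1) else f0 + 1.
have f00 : 0 <= f0 by exact: frob_ge0.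
have x0 n : 0 < x n.
  elim: n => [|n IH] /=; first by rewrite ltr_wpDl.
  by rewrite mulr_gt0 ?addr_gt0 ?mulr_gt0 ?gamma_gt0//; case: ifP.
have x_agg l : x (agg_time K l.+1).+1 =
    c * (x (agg_time K l.+1) + g * gamma (agg_time K l.+1).+1).
  by rewrite /= /agg asboolT//; exists l.
have x_step n : (forall l, (0 < l)%N -> n <> agg_time K l) ->
    x n.+1 = x n + g * gamma n.+1.
  move=> nagg; rewrite /= /agg asboolF ?mul1r// => -[l nl].
  exact: (nagg l.+1).
exists g => //; exists x.
have mA n i k : measurable_fun setT (fun w => A n w i k).
  exact: measurable_dsgd_mx.
have mC n i k : measurable_fun setT (fun w => C n w i k).
  exact: measurable_local_step.
have mAe n : measurable_fun setT (fun w => frob (center *m A n w) * e n w).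
  apply: measurable_funM => //; apply: measurable_frob => i k.
  by apply: measurable_mulmx => // *; exact: measurable_cst.
split=> //; elim=> [|n IH].
  apply: (@le_trans _ _ (\int[P]_w f0%:E)%E).
    apply: ge0_le_integral => //.
    - by move=> w _; rewrite lee_fin mulr_ge0 ?frob_ge0.
    - exact/measurable_EFinP.
    - move=> w _; rewrite lee_fin; apply: le_trans (frob_center N0 _).
      by rewrite ler_piMr ?frob_ge0.
  rewrite integral_probability_cst lee_fin /=.
  by rewrite sqrrD1; have := sqr_ge0 f0; lra.
have young : (\int[P]_w (frob (center *m C n w) * e n.+1 w)%:E <=
    ((x n + g * gamma n.+1) ^+ 2)%:E)%E.
  apply: (@integral_young (A n) (G n) (e n)) => //.
  - exact: mC.
  - by move=> w; rewrite e_ge0 e_anti.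
  - by move=> w; apply: (@e_mul_le n w _ _ (sqr_ge0 g)); exact: Gg.
  - exact: gamma_gt0.
rewrite /= /agg; have [[l nl]|nl] := pselect (exists l, n = agg_time K l.+1);
    [rewrite asboolT; last by exists l|rewrite asboolF//]; last first.
  rewrite mul1r; apply: le_trans young.
  rewrite le_eqVlt; apply/orP; left; apply/eqP; apply: eq_integral => w _.
  rewrite dsgd_mxS W_id ?mul1mx// => -[//|l] _ nE.
  by apply: nl; exists l.
have [b Cb] := step_bounded n.
apply: (@le_trans _ _ ((c ^+ 2)%:E *
    \int[P]_w (frob (center *m C n w) * e n.+1 w)%:E)%E).
  under eq_integral do rewrite dsgd_mxS.
  apply: (@expected_mixing_contraction _ _ _ P _ _ N0 (W n) (C n) (e n.+1) b) => //.
  - by move=> i j; rewrite nl; exact: independent_step.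
  - exact: exprn_gt0.
  - by rewrite nl; exact: W_contract.
rewrite exprMn [leRHS](EFinM (c ^+ 2)) lee_wpmul2l//.
by rewrite lee_fin sqr_ge0.
Qed.

End SecondMoment.

(** * Conclusion in both cases *)

Unset Implicit Arguments.

Theorem lemmaB1 (dT : measure_display) (T : measurableType dT) (R : realType)
    (P : probability T R) (N d : nat) (S : 'I_N -> finType)
    (F : forall i : 'I_N, 'cV[R]_d -> S i -> R)
    (Q : forall i : 'I_N, S i -> S i -> R) (p : forall i : 'I_N, S i -> R)
    (X : forall i : 'I_N, nat -> T -> S i)
    (W : nat -> T -> 'M[R]_N) (gamma : nat -> R) (K : nat -> nat)
    (Kpos : forall m, (0 < m)%N -> (0 < K m)%N)
    (theta0 : 'I_N -> 'cV[R]_d) (L : R) :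
  (0 < N)%N ->
  (forall i x t, differentiable (F i ^~ x) t) ->
  (forall i, markov_chain P (Q i) (X i)) ->
  (forall i, stationary_dist (Q i) (p i)) ->
  (forall n, (0 < n)%N -> 0 < gamma n) ->
  (forall n i j, measurable_fun setT (fun w => W n w i j)) ->
  (forall n, (forall l, (0 < l)%N -> n <> agg_time K l) ->
     forall w, W n w = 1%:M) ->
  regular_gradients p F L ->
  (bounded_intervals Kpos gamma \/ increasing_intervals Kpos gamma L) ->
  (forall i, {ae P, forall w,
     has_ubound (range (fun n => norm2 (dsgd F X W gamma theta0 n w i)))}) ->
  contractive_communication P X W K ->
  let Theta := fun n w => stack (dsgd F X W gamma theta0 n w) in
  let phi : (nat -> R) -> nat -> T -> 'cV[R]_(N * d) := fun s n w =>
    (s n.+1)^-1 *: (disagreement_mx R N d *m Theta n w) in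
  forall Omega : set 'cV[R]_(N * d), compact Omega ->
    (bounded_intervals Kpos gamma ->
       bounded_second_moment_on P Theta (phi gamma) Omega) /\
    (increasing_intervals Kpos gamma L ->
       bounded_second_moment_on P Theta (phi (eff_step Kpos gamma L)) Omega).
Proof.
move=> N0 _ mcX _ gamma_gt0 mW W_id [L0 F_lip _ _] _ _ [W_data dsW W_indep [C1 C11 W_C1]].
move=> Theta phi Omega cpO.
(* (E) contracts squared norms, hence the square root; the maximum with 1/2 keeps c positive
   whatever C1 is. *)
pose c2 := Num.max C1 (1 / 2); pose c := Num.sqrt c2.
have c20 : 0 < c2 by rewrite lt_max; apply/orP; right; lra.
have c21 : c2 < 1 by rewrite gt_max C11; lra.
have c0 : 0 < c by rewrite sqrtr_gt0.
have cE : c ^+ 2 = c2 by rewrite sqr_sqrtr// ltW.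
have c1 : c < 1 by rewrite -(@ltr_pXn2r _ 2)// ?nnegrE ?ltW// expr1n cE.
have mX i m (x : S i) : measurable (X i m @^-1` [set x]) by case: (mcX i).
have W_c2 l : (0 < l)%N ->
    spectral_norm (expected_gram P (W (agg_time K l)) - avg_mx R N) <= c ^+ 2.
  by move=> l0; rewrite cE (le_trans (W_C1 _ l0))// le_max lexx.
have [g g0 [x [x0 x_agg x_step x_meas x_moment]]] := second_moment_recursion
  N0 theta0 Kpos mX gamma_gt0 mW W_id L0 F_lip W_data dsW W_indep c0 W_c2 cpO.
(* Both cases are instances, with s = gamma and s = eta: on the event, the second moment of phi_n is
   at most (x_n / s_{n+1})^2 <= C^2. *)
have moment (s : nat -> R) : (forall n, (0 < n)%N -> 0 < s n) ->
    slowly_varying K gamma s c -> bounded_second_moment_on P Theta (phi s) Omega.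
  move=> s0 [r [C0 [l0 [r0 C00 cr h]]]].
  have [C Cp xC] : exists2 C, 0 < C & forall n, x n <= C * s n.+1.
    apply: (@step_recursion_bound _ K Kpos gamma s x c g r C0 l0) => //.
    - by move=> n n0; rewrite ltW ?gamma_gt0.
    - by move=> l m ll tm; case: (h _ ll) => + _ _ _; apply.
    - by move=> l ll; case: (h _ ll).
    - by move=> l ll; case: (h _ ll).
    - by move=> l n ll ln nl; case: (h _ ll) => _ _ _; apply.
  apply: (@le_lt_trans _ _ (C ^+ 2)%:E); last exact: ltry.
  apply: ub_ereal_sup => _ [n _ <-]; rewrite unlock.
  have sp := s0 n.+1 isT.
  under eq_integral => w _.
    rewrite /phi norm2_frob frobZ -norm2_frob norm2_disagreement -mulrA EFinM.
    over.
  rewrite ge0_integralZl//; last 3 first.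
  - by have /measurable_EFinP := x_meas n.
  - by move=> w _; rewrite lee_fin mulr_ge0 ?frob_ge0.
  - by rewrite lee_fin sqr_ge0.
  apply: (@le_trans _ _ (((s n.+1)^-1 ^+ 2)%:E * (x n ^+ 2)%:E)%E).
    by rewrite lee_wpmul2l ?lee_fin ?sqr_ge0//; exact: x_moment.
  rewrite -EFinM lee_fin -exprMn ler_pXn2r ?nnegrE ?(ltW Cp)//.
    by rewrite mulrC ler_pdivrMr.
  by rewrite mulr_ge0 ?invr_ge0 ?ltW.
split=> h.
  exact/(moment _ gamma_gt0)/(bounded_intervals_slowly_varying c0 c1 h).
apply: moment; last exact: increasing_intervals_slowly_varying L0 c0 c1 h.
move=> n n0; rewrite /eff_step mulr_gt0 ?gamma_gt0// powR_gt0// ltr0n Kpos//.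
by rewrite /tau; case: ex_minnP => m /andP[].
Qed.
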